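(* Let $G$ be a connected, simply connected complex simple Lie group of rank $r$ with Cartan matrix $(a_{ij})$, let $w=s_{i_1}\cdots s_{i_r}$ be a reduced decomposition of a Coxeter element, and let $A_i,B_i,C_i,D_i\in\mathbb C^\times$ ($1\le i\le r$). With $UL^{-1}\in G$ and $\chi^\pm_i$ as defined in the context, for every finite-dimensional representation $V$ of $G$ with character $\mathrm{Ch}_V$, $$\mathrm{Ch}_V(UL^{-1})=\mathrm{Ch}_V\Big(\prod_{j=1}^r\Big(\frac{\chi^+_j}{\chi^-_j}\Big)^{h^j}\phi_{i_1}(g_{i_1})\cdots\phi_{i_r}(g_{i_r})\Big)=\mathrm{Ch}_V\Big(\prod_{j=1}^r\Big(\frac{\chi^+_j}{\chi^-_j}\Big)^{h^j}\phi_{i_1}(\bar g_{i_1})\cdots\phi_{i_r}(\bar g_{i_r})\Big),$$ where $$g_i=\begin{pmatrix}1-\chi^-_i&\chi^-_i\\-1&1\end{pmatrix},\qquad \bar g_i=\begin{pmatrix}1&\chi^+_i\\-1&1-\chi^+_i\end{pmatrix}.$$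
   Context: $x_i^\pm,h_i$ are Chevalley generators of $\mathrm{Lie}(G)$: $[h_i,x_j^\pm]=\pm a_{ij}x_j^\pm$, $[x_i^+,x_j^-]=\delta_{ij}h_i$. $\phi_i:SL_2\to G$ is the homomorphism whose differential sends the standard basis $E,H,F$ of $\mathfrak{sl}_2$ to $x_i^+,h_i,x_i^-$. Put $$U_i(A,B)=\phi_i\begin{pmatrix}A&B\\0&A^{-1}\end{pmatrix},\quad L_i(D,C)=\phi_i\begin{pmatrix}D&0\\C&D^{-1}\end{pmatrix},$$ $$UL^{-1}=U_{i_1}(A_{i_1},B_{i_1})\cdots U_{i_r}(A_{i_r},B_{i_r})\,L_{i_1}(D_{i_1},C_{i_1})^{-1}\cdots L_{i_r}(D_{i_r},C_{i_r})^{-1}.$$ A Coxeter element is a product of all simple reflections, each appearing exactly once. For $i=i_\beta$ let $\{i\}_+=\{i_\gamma:\gamma>\beta\}$, $\{i\}_-=\{i_\gamma:\gamma<\beta\}$, and $$V_i=B_iA_i\prod_{j\in\{i\}_-}A_j^{a_{ji}},\quad W_i=C_iD_i^{-1}\prod_{j\in\{i\}_+}D_j^{-a_{ji}},\quad \chi^+_i=V_iW_i,\quad \chi^-_i=\chi^+_i\prod_{j=1}^r\Big(\frac{A_j}{D_j}\Big)^{-a_{ji}} .$$ The elements $h^j$ are defined by $h_j=\sum_ia_{ji}h^i$. The element $\prod_j(\chi^+_j/\chi^-_j)^{h^j}$ is understood as $\prod_j(A_j/D_j)^{h_j}\in G$, where $z^{h_j}=\phi_j(\mathrm{diag}(z,z^{-1}))$;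 this is consistent since $\chi^+_i/\chi^-_i=\prod_j(A_j/D_j)^{a_{ji}}$. *)

(* Defs.v *)
From HB Require Import structures.
From mathcomp Require Import all_boot all_order all_algebra.
From mathcomp Require Import complex.
From mathcomp Require Import boolp classical_sets functions reals topology.
From mathcomp Require Import normedtype derive.

Set Implicit Arguments.
Unset Strict Implicit.
Unset Printing Implicit Defensive.

Import Order.TTheory GRing.Theory Num.Theory.
Import numFieldNormedType.Exports.

Local Open Scope classical_set_scope.
Local Open Scope ring_scope.

(* The topology of C = R[i] is that of its modulus, as for any [numFieldType]. *)
HB.instance Definition _ (R : realType) := NormedModule.copy R[i] R[i]^o.

(** * Complex Lie groups *)

HB.mixin Record isTopologicalGroup G of Group G & Topological G := {
  mulg_continuous : continuous (fun xy : G * G => (xy.1 * xy.2)%g);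
  invg_continuous : continuous (fun x : G => (x^-1)%g)
}.

#[short(type="topGroupType")]
HB.structure Definition TopologicalGroup :=
  {G of Group G & Topological G & isTopologicalGroup G}.

(* [chart_fun] and [chart_inv] are total; their values are meaningful only on
   [chart_dom] and on its image. *)
Record chart (R : realType) (n : nat) (G : topologicalType) := Chart {
  chart_dom : set G;
  chart_fun :> G -> 'rV[R[i]]_n;
  chart_inv : 'rV[R[i]]_n -> G;
  chart_dom_open : open chart_dom;
  chart_im_open : open (chart_fun @` chart_dom);
  chart_funK : forall x, chart_dom x -> chart_inv (chart_fun x) = x;
  chart_fun_continuous : forall x, chart_dom x -> {for x, continuous chart_fun};
  chart_inv_continuous :
    forall x, chart_dom x -> {for chart_fun x, continuous chart_inv}
}.

(* All the maps below are required to be complex differentiable at every point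
   of the open set where they are defined, i.e. to be holomorphic. *)
Record complexLieGroup (R : realType) (n : nat) (G : topGroupType) :=
  ComplexLieGroup {
  atlas : set (chart R n G);
  lie_hausdorff : hausdorff_space G;
  lie_second_countable : @second_countable G;
  atlas_cover : forall x : G, exists2 c, atlas c & chart_dom c x;
  atlas_transition : forall c d, atlas c -> atlas d ->
    forall x, chart_dom c x -> chart_dom d x ->
    differentiable (fun p => d (chart_inv c p)) (c x);
  mulg_holomorphic : forall c d e, atlas c -> atlas d -> atlas e ->
    forall x y, chart_dom c x -> chart_dom d y -> chart_dom e (x * y)%g ->
    differentiable (fun p : 'rV[R[i]]_n * 'rV[R[i]]_n =>
                      e (chart_inv c p.1 * chart_inv d p.2)%g) (c x, d y);
  invg_holomorphic : forall c d, atlas c -> atlas d ->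
    forall x, chart_dom c x -> chart_dom d (x^-1)%g ->
    differentiable (fun p => d ((chart_inv c p)^-1)%g) (c x)
}.

Definition path_connected (R : realType) (T : topologicalType) : Prop :=
  forall x y : T, exists gamma : R -> T,
    [/\ {within `[0, 1], continuous gamma}, gamma 0 = x & gamma 1 = y].

Definition null_homotopic (R : realType) (T : topologicalType)
    (gamma : R -> T) : Prop :=
  exists F : R * R -> T,
    [/\ {within [set` `[0, 1]] `*` [set` `[0, 1]], continuous F},
        forall t : R, 0 <= t <= 1 -> F (0, t) = gamma t,
        forall t : R, 0 <= t <= 1 -> F (1, t) = gamma 0,
        forall s : R, 0 <= s <= 1 -> F (s, 0) = gamma 0 &
        forall s : R, 0 <= s <= 1 -> F (s, 1) = gamma 0].

Definition simply_connected (R : realType) (T : topologicalType) : Prop :=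
  path_connected R T /\
  forall gamma : R -> T, {within `[0, 1], continuous gamma} ->
    gamma 0 = gamma 1 -> null_homotopic gamma.

(** * The Lie algebra *)

(* Through a chart [e] around the unit, Lie(G) = T_1 G is identified with C^n.
   The bracket is [X, Y] = ad(X) Y, where ad is the differential at 1 of
   g |-> Ad(g) and Ad(g) is the differential at 1 of y |-> g y g^-1.  It is
   stated as a ternary relation because ['D_X f p] is a junk value when the
   derivative does not exist; the bracket of two vectors always exists, but this
   relies on holomorphic maps being twice differentiable. *)
Definition is_lie_bracket (R : realType) (n : nat) (G : topGroupType)
    (e : chart R n G) (X Y Z : 'rV[R[i]]_n) : Prop :=
  let Ad (x Y : 'rV[R[i]]_n) :=
    'D_Y (fun y => e (chart_inv e x * chart_inv e y
                        * (chart_inv e x)^-1)%g) (e 1%g) in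
  is_derive (e 1%g) X (fun x => Ad x Y) Z.

Definition simple_lie_algebra (R : realType) (n : nat) (G : topGroupType)
    (e : chart R n G) : Prop :=
  (exists X Y Z, is_lie_bracket e X Y Z /\ Z != 0) /\
  forall I : {vspace 'rV[R[i]]_n},
    (forall X Y Z, Y \in I -> is_lie_bracket e X Y Z -> Z \in I) ->
    I = 0%VS \/ I = fullv.

(* Cartan matrix of finite type: the symmetrized matrix is positive definite. *)
Record cartan_matrix (r : nat) (a : 'M[int]_r) : Prop := CartanMatrix {
  cartan_diag : forall i, a i i = 2;
  cartan_offdiag : forall i j, i != j -> a i j <= 0;
  cartan_zero : forall i j, a i j = 0 -> a j i = 0;
  cartan_posdef : exists d : 'I_r -> rat,
    [/\ forall i, 0 < d i,
        forall i j, d i * (a i j)%:~R = d j * (a j i)%:~R &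
        forall v : 'I_r -> rat, (exists i, v i != 0) ->
          0 < \sum_i \sum_j v i * (d i * (a i j)%:~R) * v j]
}.

(* The h_i form a basis of a self-centralizing (Cartan) subalgebra, so that r is
   the rank. *)
Record chevalley_generators (R : realType) (n : nat) (G : topGroupType)
    (e : chart R n G) (r : nat) (a : 'M[int]_r)
    (xp xm h : 'I_r -> 'rV[R[i]]_n) : Prop := ChevalleyGenerators {
  chevalley_free : free [seq h i | i <- enum 'I_r];
  chevalley_cartan : forall X, (forall i, is_lie_bracket e (h i) X 0) ->
    X \in <<[seq h i | i <- enum 'I_r]>>%VS;
  chevalley_hh : forall i j, is_lie_bracket e (h i) (h j) 0;
  chevalley_hp : forall i j, is_lie_bracket e (h i) (xp j) (xp j *~ a i j);
  chevalley_hm : forall i j, is_lie_bracket e (h i) (xm j) (- (xm j *~ a i j));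
  chevalley_pm : forall i j,
    is_lie_bracket e (xp i) (xm j) (if i == j then h i else 0);
  chevalley_gen : forall S : {vspace 'rV[R[i]]_n},
    (forall X Y Z, X \in S -> Y \in S -> is_lie_bracket e X Y Z -> Z \in S) ->
    (forall i, xp i \in S /\ xm i \in S) -> S = fullv
}.

(** * Homomorphisms from SL_2, representations *)

Definition mx2 (K : Type) (x y z t : K) : 'M[K]_2 :=
  \matrix_(i, j) if i == 0 then (if j == 0 then x else y)
                           else (if j == 0 then z else t).

Definition SL2 (R : realType) : set 'M[R[i]]_2 := [set M | \det M = 1].

(* A map out of SL_2 is a function on all 2 x 2 matrices whose values outside
   SL_2 are irrelevant.  SL_2 is a closed submanifold of the space of matrices,
   so holomorphic means locally the restriction of a holomorphic map. *)
Record SL2_holomorphic_morphism (R : realType) (n : nat) (G : topGroupType)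
    (L : complexLieGroup R n G) (phi : 'M[R[i]]_2 -> G) : Prop :=
  SL2HolomorphicMorphism {
  SL2_morph1 : phi 1%:M = 1%g;
  SL2_morphM : forall M N, SL2 M -> SL2 N -> phi (M *m N) = (phi M * phi N)%g;
  SL2_continuous : {within @SL2 R, continuous phi};
  SL2_holomorphic : forall c, atlas L c ->
    forall M, SL2 M -> chart_dom c (phi M) ->
    exists F : 'M[R[i]]_2 -> 'rV[R[i]]_n,
      \forall N \near M, differentiable F N /\ (SL2 N -> c (phi N) = F N)
}.

(* The differential of [phi] at the unit sends [X] in sl_2 to [v]: curves in
   SL_2 with velocity [X] are mapped to curves with velocity [v]. *)
Definition SL2_differential (R : realType) (n : nat) (G : topGroupType)
    (e : chart R n G) (phi : 'M[R[i]]_2 -> G)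
    (X : 'M[R[i]]_2) (v : 'rV[R[i]]_n) : Prop :=
  forall gamma : R[i] -> 'M[R[i]]_2,
    gamma 0 = 1%:M -> (\forall t \near (0 : R[i]), SL2 (gamma t)) ->
    is_derive (0 : R[i]) 1 gamma X ->
    is_derive (0 : R[i]) 1 (fun t => e (phi (gamma t))) v.

Definition SL2_triple_morphism (R : realType) (n : nat) (G : topGroupType)
    (L : complexLieGroup R n G) (e : chart R n G)
    (xp h xm : 'rV[R[i]]_n) (phi : 'M[R[i]]_2 -> G) : Prop :=
  [/\ SL2_holomorphic_morphism L phi,
      SL2_differential e phi (mx2 0 1 0 0) xp,
      SL2_differential e phi (mx2 1 0 0 (-1)) h &
      SL2_differential e phi (mx2 0 0 1 0) xm].

Record representation (R : realType) (n : nat) (G : topGroupType)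
    (L : complexLieGroup R n G) (m : nat) (rho : G -> 'M[R[i]]_m) : Prop :=
  Representation {
  repr1 : rho 1%g = 1%:M;
  reprM : forall x y, rho (x * y)%g = rho x *m rho y;
  repr_holomorphic : forall c, atlas L c -> forall x, chart_dom c x ->
    differentiable (fun p => rho (chart_inv c p)) (c x)
}.

Definition character (R : realType) (G : topGroupType) (m : nat)
    (rho : G -> 'M[R[i]]_m) (g : G) : R[i] := \tr (rho g).

(** * Coxeter elements *)

(* The Weyl group acts on the root lattice, with simple roots as basis:
   s_i (alpha_l) = alpha_l - a_il alpha_i, acting on column vectors. *)
Definition simple_reflection (r : nat) (a : 'M[int]_r) (i : 'I_r) : 'M[int]_r :=
  \matrix_(k, l) ((k == l)%:R - (k == i)%:R * a i l).

Definition word_product (r : nat) (a : 'M[int]_r) (s : seq 'I_r) : 'M[int]_r :=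
  \big[mulmx/1%:M]_(i <- s) simple_reflection a i.

Definition coxeter_element (r : nat) (a : 'M[int]_r) (w : 'M[int]_r) : Prop :=
  exists2 s : seq 'I_r, (forall i, count_mem i s = 1%N) & w = word_product a s.

Definition reduced_decomposition (r : nat) (a : 'M[int]_r) (w : 'M[int]_r)
    (s : seq 'I_r) : Prop :=
  w = word_product a s /\
  forall s' : seq 'I_r, w = word_product a s' -> (size s <= size s')%N.

(** * Factors and coordinates *)

Definition after (r : nat) (w : r.-tuple 'I_r) (i : 'I_r) : {set 'I_r} :=
  [set j | [exists beta : 'I_r, exists gamma : 'I_r,
    [&& tnth w beta == i, tnth w gamma == j & (beta < gamma)%N]]].

Definition before (r : nat) (w : r.-tuple 'I_r) (i : 'I_r) : {set 'I_r} :=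
  [set j | [exists beta : 'I_r, exists gamma : 'I_r,
    [&& tnth w beta == i, tnth w gamma == j & (gamma < beta)%N]]].

Section Factorization.
Variables (R : realType) (G : topGroupType) (r : nat) (a : 'M[int]_r).
Variables (phi : 'I_r -> 'M[R[i]]_2 -> G) (w : r.-tuple 'I_r).
Variables (A B C D : 'I_r -> R[i]).

Definition ULinv : G :=
  (\big[*%g/1]_(i <- w) phi i (mx2 (A i) (B i) 0 (A i)^-1%R)
   * \big[*%g/1]_(i <- w) (phi i (mx2 (D i) 0 (C i) (D i)^-1%R))^-1)%g.

Definition Vcoord (i : 'I_r) : R[i] :=
  B i * A i * \prod_(j in before w i) A j ^ a j i.

Definition Wcoord (i : 'I_r) : R[i] :=
  C i * (D i)^-1 * \prod_(j in after w i) D j ^ (- a j i).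

Definition chip (i : 'I_r) : R[i] := Vcoord i * Wcoord i.

Definition chim (i : 'I_r) : R[i] :=
  chip i * \prod_(j < r) (A j / D j) ^ (- a j i).

(* prod_j (chip_j / chim_j)^(h^j), read as prod_j (A_j / D_j)^(h_j). *)
Definition chi_torus : G :=
  (\big[*%g/1]_(j < r) phi j (mx2 (A j / D j)%R 0 0 (A j / D j)^-1%R))%g.

Definition gmx (i : 'I_r) : 'M[R[i]]_2 := mx2 (1 - chim i) (chim i) (-1) 1.

Definition gbarmx (i : 'I_r) : 'M[R[i]]_2 := mx2 1 (chip i) (-1) (1 - chip i).

End Factorization.

(* Main.v *)
(**
  Write x_i(t), y_i(t), z^{h_i} for the images under rho of the one-parameter
  subgroups of G.  Three relations suffice: x_i(s) and y_j(t) commute for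
  i <> j, and z^{h_i} conjugates x_j(t) into x_j(z^{a_ij} t) and y_j(t) into
  y_j(z^{-a_ij} t).  They hold because the differential of rho turns the bracket
  of Lie(G) into the commutator of matrices, so that functions such as
  z |-> z^{-a} z^{h} x z^{-h} have zero derivative and are constant.

  Moving the torus parts of U to the right and those of L^-1 to the left gives
  U L^-1 = (prod x_i(V_i)) T (prod y_i(-W_i)) with T = prod (A_j/D_j)^{h_j}.
  Under the trace, the y's may be cycled to the front or T moved to the front;
  as y_i commutes with x_j for i <> j, the two products interleave into
  prod y_i(-W_i) x_i(V_i), resp. prod x_i(V_i / alpha_i(T)) y_i(-W_i).  Finally
  conjugation by a torus element t with alpha_i(t) = W_i, which exists since the
  Cartan matrix is invertible, produces gbar_i, resp. g_i.  Every i occurs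
  exactly once in the reduced word: a row vector fixed by a Coxeter element is
  zero, whereas a simple reflection s_j fixes the i-th coordinate form for
  j <> i.
*)

Require Import Defs.
From HB Require Import structures.
From mathcomp Require Import all_boot all_order all_algebra.
From mathcomp Require Import complex.
From mathcomp Require Import boolp classical_sets functions reals topology.
From mathcomp Require Import normedtype derive.
From mathcomp Require Import realfun ring.

Set Implicit Arguments.
Unset Strict Implicit.
Unset Printing Implicit Defensive.

Import Order.TTheory GRing.Theory Num.Theory.
Import numFieldNormedType.Exports.

Local Open Scope classical_set_scope.
Local Open Scope ring_scope.

(** * Matrix-valued derivatives *)

Section MatrixDerivative.
Variables (K : numFieldType).

(** [f] is only derivable along [v], so it is restricted to the line [h *: v + x], where
    derivability in the scalar [h] amounts to differentiability and the chain rule for differentials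
    applies. *)
Lemma is_derive_comp (V U W : normedModType K) (f : V -> U) (g : U -> W)
    (x v : V) (df : U) :
  is_derive x v f df -> differentiable g (f x) ->
  is_derive x v (g \o f) ('d g (f x) df).
Proof.
move=> [fxv <-] dg.
pose f1 (h : K) := f (h *: v + x).
have f10 : f1 0 = f x by rewrite /f1 scale0r add0r.
have df1 : differentiable f1 0.
  by apply/derivable1_diffP; apply: (derivable1P f x v).1.
have dg1 : differentiable g (f1 0) by rewrite f10.
have d1 : differentiable (g \o f1) 0 by apply: differentiable_comp.
have ED (W' : normedModType K) (q : V -> W') :
    'D_1 (fun h : K => q (h *: v + x)) 0 = 'D_v q x.
  rewrite /derive.
  set F1 := (X in lim (X @ _)); set F2 := (X in _ = lim (X @ _)).
  suff -> : F1 = F2 by [].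
  apply/funext => h; rewrite /F1 /F2 /=.
  by rewrite addr0 scale0r add0r [_%:A]mulr1.
apply: DeriveDef.
  apply/(derivable1P (g \o f) x v).2.
  exact: (derivable1_diffP (g \o f1) 0).2.
rewrite -ED -[LHS]/('D_1 (g \o f1) 0) deriveE // diff_comp //= f10.
by rewrite -(ED _ f) -/f1 (deriveE _ df1).
Qed.

(* Entrywise, as the library relates matrix derivatives to those of the entries
   only over a [realFieldType]. *)
Definition mx_derive (V : normedModType K) m n (x v : V)
    (F : V -> 'M[K]_(m, n)) (F' : 'M[K]_(m, n)) :=
  forall i j, is_derive x v (fun y => F y i j) (F' i j).

Variables (V : normedModType K).
Implicit Types x v : V.

Lemma mx_derive_cst m n x v (M : 'M[K]_(m, n)) : mx_derive x v (fun=> M) 0.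
Proof. by move=> i j; rewrite mxE; apply: is_derive_cst. Qed.

Lemma mx_deriveM m n p x v (F : V -> 'M[K]_(m, n)) (G : V -> 'M[K]_(n, p))
    F' G' :
  mx_derive x v F F' -> mx_derive x v G G' ->
  mx_derive x v (fun y => F y *m G y) (F x *m G' + F' *m G x).
Proof.
move=> dF dG i j.
have -> : (fun y => (F y *m G y) i j) =
    \sum_(k < n) ((fun y => F y i k) * (fun y => G y k j)).
  by apply/funext => y; rewrite mxE fct_sumE.
have Hk (k : 'I_n) := is_deriveM (dF i k) (dG k j).
have H := is_derive_sum Hk.
apply: is_derive_eq.
rewrite !mxE -big_split /=; apply: eq_bigr => k _.
by congr (_ + _); rewrite mulrC.
Qed.

Lemma mx_derive_unique m n x v (F : V -> 'M[K]_(m, n)) F1 F2 :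
  mx_derive x v F F1 -> mx_derive x v F F2 -> F1 = F2.
Proof.
move=> d1 d2; apply/matrixP => i j.
by case: (d1 i j) => _ <-; case: (d2 i j) => _ ->.
Qed.

Lemma near_eq_mx_derive m n x v (F G : V -> 'M[K]_(m, n)) F' :
  (\forall y \near x, F y = G y) -> mx_derive x v F F' -> mx_derive x v G F'.
Proof.
move=> FG dF i j; apply: near_eq_is_derive (dF i j).
by apply: filterS FG => y ->.
Qed.

(** Reading off an entry is a continuous linear map, hence its own differential; the chain rule then
    gives the derivative of each entry. *)
Lemma is_derive_mx m n x v (F : V -> 'M[K]_(m, n)) F' :
  is_derive x v F F' -> mx_derive x v F F'.
Proof.
move=> dF i j.
have dc := differentiable_coord (F x) i j.
have := is_derive_comp dF dc.
pose g : 'M[K]_(m, n) -> K := fun M => M i j.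
have lin_g : linear g by move=> a A B; rewrite /g !mxE.
pose gM := GRing.isLinear.Build _ _ _ _ _ lin_g.
pose gL : {linear _ -> _} := HB.pack g gM.
suff -> : 'd (fun M : 'M[K]_(m, n) => M i j) (F x) F' = F' i j by [].
have := @diff_lin _ _ _ gL (F x); rewrite /gL /= => ->//.
move=> M; exact: differentiable_continuous (differentiable_coord M i j).
Qed.

End MatrixDerivative.

(** * Functions with zero complex derivative along a segment *)

Section ComplexConstant.
Local Open Scope complex_scope.
Variable R : realType.
Local Notation C := R[i].

Lemma norm_complexR (x : R) : `|x%:C| = `|x|%:C :> C.
Proof. by rewrite normc_def /= expr0n /= addr0 sqrtr_sqr. Qed.

(* [p] stands for the real part or the imaginary part. *)
Lemma is_derive0_real (p : C -> R) (f : C -> C) (t : R) :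
  (forall z, `|p z|%:C <= `|z|) -> (forall (x : R) z, p (x%:C * z) = x * p z) ->
  {morph p : x y / x - y} ->
  is_derive (t%:C : C) 1 f 0 -> is_derive t (1 : R) (fun s => p (f s%:C)) 0.
Proof.
move=> ple pZ pB [df Df].
have {df Df} cf : (fun h : C =>
    h^-1 *: ((f \o shift (t%:C : C)) (h *: (1 : C)) - f t%:C))
    @ 0^' --> (0 : C).
  have := df; rewrite /derivable /cvg_to /=; rewrite -[lim _]/('D_1 f t%:C) Df.
  exact.
suff cg : (fun h : R =>
    h^-1 *: (((fun s => p (f s%:C)) \o shift t) (h *: (1 : R)) - p (f t%:C)))
    @ 0^' --> (0 : R).
  by apply: DeriveDef; [apply/cvg_ex; exists 0 | apply/cvg_lim].
apply/cvgr0Pnorm_lt => e e0.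
have e0' : (0 : C) < e%:C by rewrite ltcR.
move/cvgr0Pnorm_lt/(_ _ e0') : cf => [d /= d0 dP].
(* The radius [d] is an element of [R[i]]; being positive, it is real. *)
have dE : d = (complex.Re d)%:C.
  by move: d0; rewrite ltcE /= => /andP[/eqP Id _]; case: (d) Id => x y /= ->.
have d0' : 0 < complex.Re d by move: d0; rewrite dE ltcR.
exists (complex.Re d) => // h /=; rewrite sub0r normrN => hd hN0.
have := dP h%:C; rewrite /= sub0r normrN norm_complexR {1}dE ltcR => /(_ hd).
have hN0' : h%:C != 0 :> C by rewrite eq_complex /= eqxx andbT.
move=> /(_ hN0').
rewrite -ltcR; apply: le_lt_trans.
apply: le_trans (ple _); rewrite lecR.
rewrite -pB /= /GRing.scale /= !mulr1 -rmorphD.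
by rewrite -[h^-1 * p _]pZ fmorphV.
Qed.

(** The mean value theorem is a real statement, so it is applied on [0, 1] to the real part and to
    the imaginary part of [f] separately. *)
Lemma is_derive0_cst01 (f : C -> C) :
  (forall t : R, 0 <= t <= 1 -> is_derive (t%:C : C) 1 f 0) -> f 0 = f 1.
Proof.
move=> df.
have key (p : C -> R) : (forall z, `|p z|%:C <= `|z|) ->
  (forall (x : R) z, p (x%:C * z) = x * p z) ->
  {morph p : x y / x - y} -> p (f 0) = p (f 1).
  move=> ple pZ pB.
  pose g (s : R) := p (f s%:C).
  have dg (t : R) : 0 <= t <= 1 -> is_derive t (1 : R) g 0.
    by move=> t01; exact: (is_derive0_real ple pZ pB (df t t01)).
  have [||c _] := @MVT_segment R g (cst 0) 0 1 (@ler01 R).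
  - move=> x; rewrite in_itv /= => /andP[x0 x1].
    by apply: dg; rewrite !ltW.
  - apply: derivable_within_continuous => x; rewrite in_itv /= => x01.
    by have [] := dg x x01.
  by rewrite /= mul0r => /eqP; rewrite subr_eq0 => /eqP.
have kR : complex.Re (f 0) = complex.Re (f 1).
  apply: key => [z|x [a b]|[a b] [c d]] //=; first exact: normc_ge_Re.
  by rewrite mul0r subr0.
have kI : complex.Im (f 0) = complex.Im (f 1).
  apply: key => [z|x [a b]|[a b] [c d]] //=; last by rewrite mul0r addr0.
  (* The imaginary part of [z] is the real part of [- i z], which has the same modulus. *)
  have := normc_ge_Re (z * (- 'i%C)); rewrite normrM mulrN raddfN /=.
  by rewrite ReiNIm opprK normrN complexiE normCi mulr1.
by move: kR kI; case: (f 0) (f 1) => a b [c d] /= -> ->.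
Qed.

Lemma is_derive0_segment (f : C -> C) (a b : C) :
  (forall t : R, 0 <= t <= 1 -> is_derive (a + t%:C * (b - a)) 1 f 0) ->
  f a = f b.
Proof.
move=> df.
have := @is_derive0_cst01 (fun t => f (a + t * (b - a))).
rewrite mul0r addr0 mul1r subrKC; apply=> t t01.
have dl : is_derive (t%:C : C) (1 : C) (fun t : C => a + t * (b - a)) (b - a).
  have -> : (fun t : C => a + t * (b - a)) = cst a + (fun t => (b - a) *: t).
    by apply/funext => s /=; rewrite mulrC.
  have := is_deriveD (is_derive_cst a (t%:C : C) (1 : C))
    (is_deriveZ (b - a) (is_derive_id (t%:C : C) (1 : C))).
  by rewrite add0r [_ *: 1]mulr1.
have [dft Dft] := df t t01.
have dd : differentiable f (a + t%:C * (b - a)) by apply/derivable1_diffP.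
have := is_derive_comp dl dd.
suff -> : 'd f (a + t%:C * (b - a)) (b - a) = 0 by [].
by rewrite diff1E // derive1E Dft scaler0.
Qed.

End ComplexConstant.

(** * The differential of a representation *)

Section RepresentationDifferential.
Variables (R : realType) (n : nat) (G : topGroupType).
Variable L : complexLieGroup R n G.
Variables (e : chart R n G) (atlas_e : atlas L e) (dom_e : chart_dom e 1%g).
Variables (m : nat) (rho : G -> 'M[R[i]]_m) (rho_repr : representation L rho).
Local Notation c := (chart_inv e).

(** The Lie algebra representation attached to [rho]: its differential at the unit, with the tangent
    space read in the chart [e]. *)
Definition repr_diff (Y : 'rV[R[i]]_n) : 'M[R[i]]_m :=
  'd (fun p => rho (c p)) (e 1%g) Y.

Lemma near_chart (g : G) : chart_dom e g ->
  \forall p \near e g, chart_dom e (c p).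
Proof.
move=> dg.
have : nbhs (e g) (e @` chart_dom e).
  by apply: open_nbhs_nbhs; split; [exact: chart_im_open | exists g].
apply: filterS => p [h dh <-].
by rewrite (chart_funK dh).
Qed.

Lemma chart_dom_nbhs (g : G) : chart_dom e g -> nbhs g (chart_dom e).
Proof.
by move=> dg; apply: open_nbhs_nbhs; split => //; exact: chart_dom_open.
Qed.

Lemma chart_inv_cvg : c p @[p --> e 1%g] --> (1%g : G).
Proof.
by rewrite -[X in _ --> X](chart_funK dom_e); exact: chart_inv_continuous.
Qed.

Lemma near_chart_invg :
  \forall p \near e 1%g, chart_dom e (c p) /\ chart_dom e (c p)^-1%g.
Proof.
have H : \forall p \near e 1%g, chart_dom e (c p)^-1%g.
  have : (c p)^-1%g @[p --> e 1%g] --> (1%g : G).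
    rewrite -[X in _ --> X]invg1.
    apply: (@cvg_comp _ _ _ c (fun x : G => x^-1)%g);
      last exact: invg_continuous.
    exact: chart_inv_cvg.
  by apply; apply: chart_dom_nbhs.
by apply: filterS2 (near_chart dom_e) H.
Qed.

Lemma cvgMg (T : Type) (F : set_system T) (FF : Filter F) (f1 f2 : T -> G)
    g1 g2 :
  f1 p @[p --> F] --> g1 -> f2 p @[p --> F] --> g2 ->
  (f1 p * f2 p)%g @[p --> F] --> (g1 * g2)%g.
Proof.
move=> f1g f2g; apply: continuous2_cvg f1g f2g.
exact: (@mulg_continuous G (g1, g2)).
Qed.

Lemma mulg_chart_cvg (g h : G) : (g * c p * h)%g @[p --> e 1%g] --> (g * h)%g.
Proof.
have c1 := chart_inv_cvg.
have := cvgMg _ (cvgMg _ (cvg_cst g) c1) (cvg_cst h).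
by rewrite mulg1; apply.
Qed.

Lemma near_mulg_chart (g h : G) : chart_dom e (g * h)%g ->
  \forall p \near e 1%g, chart_dom e (g * c p * h)%g.
Proof. by move=> d; apply: (mulg_chart_cvg (chart_dom_nbhs d)). Qed.

(** Conjugation is a left translation followed by a right translation, each holomorphic as the
    product with one argument frozen. Near the unit the intermediate point stays in the chart, so
    passing through coordinates between the two changes nothing. In particular the derivative
    defining Ad is a genuine one. *)
Lemma derivable_conjg p Y : chart_dom e (c p) -> chart_dom e (c p)^-1%g ->
  derivable (fun y => e (c p * c y * (c p)^-1)%g) (e 1%g) Y.
Proof.
set g := c p => dg dgV.
pose f1 y := e (g * c y)%g.
pose f2 z := e (c z * g^-1)%g.
have df1 : differentiable f1 (e 1%g).
  have := mulg_holomorphic atlas_e atlas_e atlas_e dg dom_e.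
  rewrite mulg1 => /(_ dg) d.
  have dp : differentiable (fun y : 'rV[R[i]]_n => (e g, y)) (e 1%g).
    by apply: differentiable_pair; [exact: differentiable_cst | exact: ex_diff].
  rewrite (_ : f1 = (fun q : 'rV[R[i]]_n * 'rV[R[i]]_n =>
      e (c q.1 * c q.2)%g) \o (fun y => (e g, y))).
    exact: differentiable_comp dp d.
  by apply/funext => y; rewrite /f1 /= chart_funK.
have df2 : differentiable f2 (f1 (e 1%g)).
  have := mulg_holomorphic atlas_e atlas_e atlas_e dg dgV.
  rewrite mulgV => /(_ dom_e) d.
  have -> : f1 (e 1%g) = e g by rewrite /f1 chart_funK // mulg1.
  have dp : differentiable (fun z : 'rV[R[i]]_n => (z, e g^-1%g)) (e g).
    by apply: differentiable_pair; [exact: ex_diff | exact: differentiable_cst].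
  rewrite (_ : f2 = (fun q : 'rV[R[i]]_n * 'rV[R[i]]_n =>
      e (c q.1 * c q.2)%g) \o (fun z => (z, e g^-1%g))).
    exact: differentiable_comp dp d.
  by apply/funext => y; rewrite /f2 /= (chart_funK dgV).
apply: (near_eq_derivable _ (diff_derivable (differentiable_comp df1 df2))).
have : \forall y \near e 1%g, chart_dom e (g * c y)%g.
  have := @near_mulg_chart g 1%g.
  by rewrite mulg1 => /(_ dg); apply: filterS => y; rewrite mulg1.
by apply: filterS => y dy; rewrite /f1 /f2 /= chart_funK.
Qed.

Lemma differentiable_repr : differentiable (fun p => rho (c p)) (e 1%g).
Proof. exact: (repr_holomorphic rho_repr atlas_e dom_e). Qed.

Lemma mx_derive_repr Y : mx_derive (e 1%g) Y (fun p => rho (c p)) (repr_diff Y).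
Proof.
apply: is_derive_mx.
apply: DeriveDef; first exact/diff_derivable/differentiable_repr.
by rewrite deriveE //; exact: differentiable_repr.
Qed.

Let Ad (x Y : 'rV[R[i]]_n) :=
  'D_Y (fun y => e (c x * c y * (c x)^-1)%g) (e 1%g).

(** With g = [c p], both sides are the derivative at the unit along [Y] of the same function of y,
    by rho(g y g^-1) rho(g) = rho(g) rho(y). *)
Lemma repr_diff_Ad Y p : chart_dom e (c p) -> chart_dom e (c p)^-1%g ->
  repr_diff (Ad p Y) *m rho (c p) = rho (c p) *m repr_diff Y.
Proof.
move=> dp dpV.
pose cj y := e (c p * c y * (c p)^-1)%g.
have cj1 : cj (e 1%g) = e 1%g by rewrite /cj (chart_funK dom_e) mulg1 mulgV.
have dcj : is_derive (e 1%g) Y cj (Ad p Y).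
  by apply: derivableP; exact: derivable_conjg.
have dr : differentiable (fun p => rho (c p)) (cj (e 1%g)).
  by rewrite cj1; exact: differentiable_repr.
have H1 := is_derive_mx (is_derive_comp dcj dr).
have {H1} := mx_deriveM H1 (mx_derive_cst (e 1%g) Y (rho (c p))).
have H2 := mx_deriveM (mx_derive_cst (e 1%g) Y (rho (c p))) (mx_derive_repr Y).
rewrite mul0mx addr0 in H2; rewrite mulmx0 add0r cj1 => H1.
apply: mx_derive_unique H1 _; apply: near_eq_mx_derive H2.
have : \forall y \near e 1%g, chart_dom e (c p * c y * (c p)^-1)%g.
  by apply: near_mulg_chart; rewrite mulgV.
apply: filterS => y dy /=.
by rewrite /cj chart_funK // -!(reprM rho_repr) -mulgA mulVg mulg1.
Qed.

(* Differentiates [repr_diff_Ad] in [p] at the unit, along [X]. *)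
Lemma repr_diff_bracket X Y Z : is_lie_bracket e X Y Z ->
  repr_diff Z = repr_diff X *m repr_diff Y - repr_diff Y *m repr_diff X.
Proof.
move=> dAd.
have rho1 : rho (c (e 1%g)) = 1%:M.
  by rewrite (chart_funK dom_e) (repr1 rho_repr).
have Ad1 : repr_diff (Ad (e 1%g) Y) = repr_diff Y.
  have := @repr_diff_Ad Y (e 1%g).
  by rewrite rho1 mulmx1 mul1mx; apply; rewrite (chart_funK dom_e) // invg1.
(* The differential of [rho] is continuous and linear, hence its own differential; this lets it be
   composed with the derivative of Ad that defines the bracket. *)
pose rdL (Y : 'rV[R[i]]_n) := repr_diff Y.
have cd : continuous rdL by apply: diff_continuous; exact: differentiable_repr.
have drd x : differentiable rdL x by apply: linear_differentiable.
have := is_derive_mx (is_derive_comp dAd (drd _)).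
rewrite [X in mx_derive _ _ _ X](_ : _ = repr_diff Z); last first.
  by rewrite diff_lin.
move=> H1.
have := mx_deriveM H1 (mx_derive_repr X).
have := mx_deriveM (mx_derive_repr X) (mx_derive_cst (e 1%g) X (repr_diff Y)).
rewrite mulmx0 add0r rho1 mulmx1 => H2 H3.
have H4 : mx_derive (e 1%g) X (fun p => repr_diff (Ad p Y) *m rho (c p))
    (repr_diff X *m repr_diff Y).
  apply: near_eq_mx_derive H2.
  by apply: filterS near_chart_invg => p [? ?]; rewrite /= repr_diff_Ad.
have := mx_derive_unique H3 H4.
rewrite -[(rdL \o _) _]/(repr_diff (Ad (e 1%g) Y)) Ad1 => <-.
by rewrite addrAC subrr add0r.
Qed.

End RepresentationDifferential.

(** * One-parameter groups of matrices *)

Section Chain.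
Variable K : numFieldType.

Lemma is_derive1_comp_num (f g : K -> K) (x a b : K) :
  is_derive (g x) 1 f a -> is_derive x 1 g b -> is_derive x 1 (f \o g) (b * a).
Proof.
move=> [df <-] dg.
have df' : differentiable f (g x) by apply/derivable1_diffP.
have := is_derive_comp dg df'.
by rewrite diff1E // derive1E.
Qed.

Lemma mx_derive_comp m n (F : K -> 'M[K]_(m, n)) (g : K -> K) (x : K) F'
    (b : K) :
  mx_derive (g x) 1 F F' -> is_derive x 1 g b ->
  mx_derive x 1 (F \o g) (b *: F').
Proof.
move=> dF dg i j; rewrite mxE.
exact: (@is_derive1_comp_num (fun y => F y i j) g x _ _ (dF i j) dg).
Qed.

Lemma mx_deriveZ m n (F : K -> 'M[K]_(m, n)) (g : K -> K) (x : K) F' (b : K) :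
  is_derive x 1 g b -> mx_derive x 1 F F' ->
  mx_derive x 1 (fun y => g y *: F y) (g x *: F' + b *: F x).
Proof.
move=> dg dF i j.
have -> : (fun y => (g y *: F y) i j) = g * (fun y => F y i j).
  by apply/funext => y; rewrite mxE.
have := is_deriveM dg (dF i j).
by congr is_derive; rewrite !mxE; congr (_ + _); exact: mulrC.
Qed.

Lemma is_derive_mull (a x : K) : is_derive x 1 (fun y => a * y) a.
Proof.
have := is_deriveZ a (is_derive_id x (1 : K)).
by rewrite [_ *: 1]mulr1.
Qed.

Lemma is_derive_inv (x : K) :
  x != 0 -> is_derive x 1 (fun y : K => y^-1) (- x^-2).
Proof.
move=> x0; have did : derivable (id : K -> K) x 1 by exact: derivable_id.
apply: DeriveDef; first exact: (derivableV x0 did).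
by rewrite (@deriveV _ _ id) // derive_id [_ *: 1]mulr1.
Qed.

Lemma is_derive_exprz1 (a : int) :
  is_derive (1 : K) 1 (fun y : K => y ^ a) a%:~R.
Proof.
have dX n : is_derive (1 : K) 1 (fun y : K => y ^+ n) n%:R.
  have := is_deriveX n (is_derive_id (1 : K) (1 : K)).
  rewrite expr1n [_ *: 1]mulr1 mulr1.
  by congr is_derive; apply/funext => y; rewrite exprfctE.
case: a => n; first exact: dX.
have dV := @is_derive_inv 1 (oner_neq0 K).
have := @is_derive1_comp_num (fun y => y^-1) (fun y : K => y ^+ n.+1) 1 _ _ _
  (dX n.+1).
rewrite /= expr1n => /(_ _ dV).
by rewrite expr1n invr1 mulrN1.
Qed.

End Chain.

Lemma near_neq0 (K : numFieldType) (z : K) :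
  z != 0 -> \forall s \near z, s != 0.
Proof.
move=> z0; have H : (id : K -> K) s @[s --> z] --> z by exact: cvg_id.
exact: (@cvgr_neq0 _ _ _ _ _ id z H z0).
Qed.

(** * Intertwining one-parameter groups through their generators *)

Section Constant.
Variable R : realType.
Local Notation C := R[i].

Lemma mx_derive0_segment m n (F : C -> 'M[C]_(m, n)) (a b : C) :
  (forall t : R, 0 <= t <= 1 -> mx_derive (a + t%:C * (b - a))%C 1 F 0) ->
  F a = F b.
Proof.
move=> dF; apply/matrixP => i j.
apply: (@is_derive0_segment R (fun t => F t i j)) => t t01.
by have := dF t t01 i j; rewrite mxE.
Qed.

(** This describes t |-> exp(t X) without the exponential series: the group law and the derivative
    at 0 suffice for what follows. *)
Definition additive_group m (X : 'M[C]_m) (u : C -> 'M[C]_m) :=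
  [/\ u 0 = 1%:M, forall s t, u (s + t) = u s *m u t & mx_derive (0 : C) 1 u X].

Lemma additive_groupZ m X (u : C -> 'M[C]_m) a :
  additive_group X u -> additive_group (a *: X) (fun t => u (a * t)).
Proof.
case=> u0 uD du; split=> [|s t|].
- by rewrite mulr0.
- by rewrite mulrDr uD.
apply: mx_derive_comp (is_derive_mull a 0).
by rewrite mulr0.
Qed.

(** The derivative at 0 is transported to [t] by writing u(s) as u(t) u(s - t), or as u(s - t)
    u(t). *)
Lemma additive_group_derive m X (u : C -> 'M[C]_m) (t : C) :
  additive_group X u ->
  mx_derive t 1 u (u t *m X) /\ mx_derive t 1 u (X *m u t).
Proof.
case=> u0 uD du.
have dB : is_derive t (1 : C) (fun s : C => s - t) 1.
  have := is_deriveB (is_derive_id t (1 : C)) (is_derive_cst t t (1 : C)).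
  by rewrite subr0.
have := @mx_derive_comp _ _ _ u (fun s => s - t) t X 1.
rewrite subrr scale1r => /(_ du dB) d.
split.
  have := mx_deriveM (mx_derive_cst t (1 : C) (u t)) d.
  rewrite mul0mx addr0.
  by congr mx_derive; apply/funext => s /=; rewrite -uD subrKC.
have := mx_deriveM d (mx_derive_cst t (1 : C) (u t)).
rewrite mulmx0 add0r.
by congr mx_derive; apply/funext => s /=; rewrite -uD subrK.
Qed.

(** The function s |-> v(-s) M u(s) has derivative v(-s) (M X - Y M) u(s) = 0, so its values at 0
    and at [t] agree. *)
Lemma additive_group_intertwine m X Y (u v : C -> 'M[C]_m) (M : 'M[C]_m)
    (t : C) :
  additive_group X u -> additive_group Y v -> M *m X = Y *m M ->
  M *m u t = v t *m M.
Proof.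
move=> gu gv MX.
have gv' := additive_groupZ (-1) gv.
have [[u0 _ _] [v0 vD _]] := (gu, gv).
have key : v (-1 * 0) *m M *m u 0 = v (-1 * t) *m M *m u t.
  apply: (@mx_derive0_segment m m (fun s => v (-1 * s) *m M *m u s)) => s _.
  set z := (_ + _).
  have [d1 _] := additive_group_derive z gv'.
  have [_ d2] := additive_group_derive z gu.
  have := mx_deriveM (mx_deriveM d1 (mx_derive_cst z (1 : C) M)) d2.
  rewrite mulmx0 add0r.
  suff -> : v (-1 * z) *m M *m (X *m u z) +
      v (-1 * z) *m (-1 *: Y) *m M *m u z = 0 by [].
  rewrite -[_ *m M *m (X *m _)]mulmxA (mulmxA M) MX scaleN1r mulmxN !mulNmx.
  by rewrite !mulmxA subrr.
move: key; rewrite mulr0 v0 u0 mul1mx mulmx1 => key; rewrite [in RHS]key.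
by rewrite !mulmxA -vD mulN1r subrr v0 mul1mx.
Qed.

(** The analogue z |-> z^H on the nonzero complex numbers; the value at 0 is arbitrary, whence the
    side conditions in the group law. *)
Definition multiplicative_group m (H : 'M[C]_m) (h : C -> 'M[C]_m) :=
  [/\ h 1 = 1%:M, forall s t, s != 0 -> t != 0 -> h (s * t) = h s *m h t &
      mx_derive (1 : C) 1 h H].

Lemma multiplicative_group_derive m H (h : C -> 'M[C]_m) (z : C) : z != 0 ->
  multiplicative_group H h ->
  mx_derive z 1 h (z^-1 *: (h z *m H)) /\ mx_derive z 1 h (z^-1 *: (H *m h z)).
Proof.
move=> z0 [h1 hM dh].
have := @mx_derive_comp _ _ _ h (fun s => z^-1 * s) z H z^-1.
rewrite mulVf // => /(_ dh (is_derive_mull _ _)) d.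
have nz : \forall s \near z, z^-1 * s != 0.
  by apply: filterS (near_neq0 z0) => s s0; rewrite mulf_neq0 ?invr_eq0.
split.
  have := mx_deriveM (mx_derive_cst z (1 : C) (h z)) d.
  rewrite mul0mx addr0 -scalemxAr.
  apply: near_eq_mx_derive; apply: filterS nz => s s0 /=.
  by rewrite -hM // mulVKf.
have := mx_deriveM d (mx_derive_cst z (1 : C) (h z)).
rewrite mulmx0 add0r -scalemxAl.
apply: near_eq_mx_derive; apply: filterS nz => s s0 /=.
by rewrite -hM // mulrC mulVKf.
Qed.

(* The segment from 1 to z avoids 0 unless z is a negative real, so z is
   replaced by one of its square roots. *)
Lemma multiplicative_group_intertwine m H K (h k : C -> 'M[C]_m) (M : 'M[C]_m)
    (z : C) :
  multiplicative_group H h -> multiplicative_group K k -> M *m H = K *m M ->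
  z != 0 -> M *m h z = k z *m M.
Proof.
move=> gh gk MH.
have [[h1 hM _] [k1 kM _]] := (gh, gk).
(* Here s |-> k(s^-1) M h(s) has zero derivative along the segment from 1 to [w], provided that the
   segment avoids 0. *)
have half w : w != 0 -> ~~ (w < 0) -> M *m h w = k w *m M.
  move=> w0 wN.
  have key : k 1^-1 *m M *m h 1 = k w^-1 *m M *m h w.
    apply: (@mx_derive0_segment m m (fun s => k s^-1 *m M *m h s)) => s s01.
    set y := (_ + _).
    have y0 : y != 0.
      (* If the segment met 0 at parameter s, then w = 1 - 1/s with 0 < s <= 1; as [w] is nonzero,
         it would be negative. *)
      apply: contra wN => /eqP y0.
      have sN : s%:C%C != 0 :> C.
        apply/eqP => s0; move: y0; rewrite /y s0 mul0r addr0 => /eqP.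
        by rewrite oner_eq0.
      have wE : w = 1 - (s%:C%C)^-1.
        apply: (mulfI sN); rewrite mulrBr divff // mulr1.
        apply/eqP; rewrite -subr_eq0 opprB addrCA -[X in _ + (_ - X)]mulr1.
        by rewrite -mulrBr -/y y0.
      rewrite lt_neqAle w0 wE subr_le0 -fmorphV lecR /=.
      have s0 : 0 < s.
        case/andP: s01 => s0 _; rewrite lt_neqAle s0 andbT eq_sym.
        by apply: contraNneq sN => ->.
      by rewrite invf_ge1 //; case/andP: s01.
    have yV0 : y^-1 != 0 by rewrite invr_eq0.
    have [dk _] := multiplicative_group_derive yV0 gk.
    have [_ dh] := multiplicative_group_derive y0 gh.
    have d1 := mx_derive_comp dk (is_derive_inv y0).
    have := mx_deriveM (mx_deriveM d1 (mx_derive_cst y (1 : C) M)) dh.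
    rewrite mulmx0 add0r /=.
    set D := (X in mx_derive _ _ _ X); suff -> : D = 0 by [].
    rewrite /D invrK scalerA mulNr expr2 invfM -mulrA mulVf // mulr1 scaleNr.
    rewrite !mulNmx -!scalemxAl -!scalemxAr mulmxA -(mulmxA _ M) MH mulmxA.
    by rewrite subrr.
  move: key; rewrite invr1 k1 h1 mul1mx mulmx1 => key; rewrite [in RHS]key.
  by rewrite !mulmxA -kM ?invr_eq0 // divff // k1 mul1mx.
move=> z0.
have [w w0 [wN ->]] : exists2 w : C, w != 0 & ~~ (w < 0) /\ z = w * w.
  pose w := sqrtC z; have wz : z = w * w by rewrite -expr2 sqrtCK.
  have w0 : w != 0 by apply: contraNneq z0 => w0; rewrite wz w0 mul0r.
  have [wlt0|wN] := boolP (w < 0); last by exists w.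
  (* A negative root is exchanged for its opposite, which is positive. *)
  exists (- w); rewrite ?oppr_eq0 // mulrNN; split=> //.
  by rewrite oppr_lt0 lt_gtF.
by rewrite hM // kM // mulmxA half // -mulmxA half // mulmxA.
Qed.

End Constant.

(** * The one-parameter subgroups of SL_2 *)

Section Mx2.
Variable K : comNzRingType.

Lemma det_mx2 (x y z t : K) : \det (mx2 x y z t) = x * t - y * z.
Proof.
rewrite (expand_det_row _ ord0) !big_ord_recl big_ord0 addr0 /cofactor.
rewrite !(@expand_det_row _ 1 _ ord0) !big_ord_recl !big_ord0 !addr0.
by rewrite /cofactor !det_mx00 !mxE /= !expr0 !expr1 !mul1r !mulr1 mulN1r mulrN.
Qed.

Lemma mulmx2 (x y z t x' y' z' t' : K) :
  mx2 x y z t *m mx2 x' y' z' t' =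
  mx2 (x * x' + y * z') (x * y' + y * t') (z * x' + t * z') (z * y' + t * t').
Proof.
apply/matrixP => i j; rewrite !mxE !big_ord_recl big_ord0 addr0 !mxE /=.
by case: i => [[|[|//]]] ?; case: j => [[|[|//]]] ?.
Qed.

Lemma mx2_1 : mx2 1 0 0 1 = 1%:M :> 'M[K]_2.
Proof.
apply/matrixP => i j; rewrite !mxE /=.
by case: i => [[|[|//]]] ?; case: j => [[|[|//]]] ?.
Qed.

Lemma mx2D (x y z t x' y' z' t' : K) :
  mx2 x y z t + mx2 x' y' z' t' = mx2 (x + x') (y + y') (z + z') (t + t').
Proof.
by apply/matrixP => i j; rewrite !mxE; case: (i == 0); case: (j == 0).
Qed.

Lemma mx2Z (a x y z t : K) :
  a *: mx2 x y z t = mx2 (a * x) (a * y) (a * z) (a * t).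
Proof.
by apply/matrixP => i j; rewrite !mxE; case: (i == 0); case: (j == 0).
Qed.

End Mx2.

Section OneParameter.
Variables (R : realType) (n : nat) (G : topGroupType).
Variable L : complexLieGroup R n G.
Variables (e : chart R n G) (atlas_e : atlas L e) (dom_e : chart_dom e 1%g).
Variables (m : nat) (rho : G -> 'M[R[i]]_m) (rho_repr : representation L rho).
Variables (xp h xm : 'rV[R[i]]_n) (phi : 'M[R[i]]_2 -> G).
Hypothesis phi_morphism : SL2_triple_morphism L e xp h xm phi.
Local Notation C := R[i].
Local Notation dr := (repr_diff e rho).

Lemma SL2_mx2 (x y z t : C) : x * t - y * z = 1 -> SL2 (mx2 x y z t).
Proof. by rewrite /SL2 /= det_mx2. Qed.

Lemma repr_SL2M M N : SL2 M -> SL2 N ->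
  rho (phi (M *m N)) = rho (phi M) *m rho (phi N).
Proof.
move=> sM sN; have [[_ phiM _ _] _ _ _] := phi_morphism.
by rewrite phiM // (reprM rho_repr).
Qed.

Lemma repr_SL2_1 : rho (phi 1%:M) = 1%:M.
Proof.
by have [[-> _ _ _] _ _ _] := phi_morphism; rewrite (repr1 rho_repr).
Qed.

(** By continuity of [phi] on SL_2, phi(gamma(t)) stays in the domain of [e] for small t. There the
    function factors through the chart, and the chain rule applies. *)
Lemma mx_derive_SL2 (X : 'M[C]_2) v (gamma : C -> 'M[C]_2) :
  SL2_differential e phi X v ->
  gamma 0 = 1%:M -> (\forall t \near (0 : C), SL2 (gamma t)) ->
  is_derive (0 : C) 1 gamma X ->
  mx_derive (0 : C) 1 (fun t => rho (phi (gamma t))) (dr v).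
Proof.
move=> dphi g0 gS dg.
have [[phi1 _ phiC _] _ _ _] := phi_morphism.
have de := dphi _ g0 gS dg.
have eg0 : e (phi (gamma 0)) = e 1%g by rewrite g0 phi1.
have dr1 : differentiable (fun p => rho (chart_inv e p)) (e (phi (gamma 0))).
  by rewrite eg0; exact: (differentiable_repr atlas_e dom_e rho_repr).
have := is_derive_mx (is_derive_comp de dr1).
rewrite eg0; apply: near_eq_mx_derive.
have gc : gamma t @[t --> (0 : C)] --> (1%:M : 'M[C]_2).
  rewrite -g0; apply: differentiable_continuous; apply/derivable1_diffP.
  by case: dg.
have S1 : SL2 (1%:M : 'M[C]_2) by rewrite /SL2 /= det1.
have pc : phi M @[M --> within (@SL2 R) (nbhs (1%:M : 'M[C]_2))] --> (1%g : G).
  by rewrite -[X in _ --> X]phi1; move/subspace_continuousP : phiC => /(_ _ S1).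
have /pc : nbhs (1%g : G) (chart_dom e) by exact: chart_dom_nbhs.
rewrite /= => /gc H.
by apply: filterS2 gS H => t sg /(_ sg) dt; rewrite /= chart_funK.
Qed.

Lemma is_derive_scalel (N : 'M[C]_2) (g : C -> C) (x b : C) :
  is_derive x 1 g b -> is_derive x 1 (fun t => g t *: N) (b *: N).
Proof.
move=> dg.
have ds : is_diff (g x) (fun k : C => k *: N) (fun k : C => k *: N).
  exact: is_diff_scalel.
have := is_derive_comp dg (@ex_diff _ _ _ _ _ _ _ ds).
by rewrite (@diff_val _ _ _ _ _ _ _ ds).
Qed.

(** The condition a c = 0 treats E and F together: the matrix N = [mx2 0 a c 0] then squares to
    zero, so 1 + t N has determinant 1 and is additive in t. *)
Lemma additive_group_SL2 (a c : C) (v : 'rV[C]_n) : a * c = 0 ->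
  SL2_differential e phi (mx2 0 a c 0) v ->
  additive_group (dr v) (fun t => rho (phi (mx2 1 (t * a) (t * c) 1))).
Proof.
move=> ac0 dphi.
have S t : SL2 (mx2 1 (t * a) (t * c) 1).
  by apply: SL2_mx2; rewrite mulrACA ac0 mulr0 subr0 mulr1.
split.
- by rewrite !mul0r mx2_1 repr_SL2_1.
- move=> s t; rewrite -repr_SL2M // mulmx2 !mul1r !mulr1.
  rewrite ![_ * a * (_ * c)]mulrACA [s * c * _]mulrACA [c * a]mulrC ac0.
  rewrite !mulr0 !addr0 add0r.
  by rewrite -!mulrDl [t + s]addrC.
apply: mx_derive_SL2 dphi _ _ _; first by rewrite !mul0r mx2_1.
  by apply: filterE => t; exact: S.
have := is_deriveD (is_derive_cst (1%:M : 'M[C]_2) (0 : C) (1 : C))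
  (is_derive_scalel (mx2 0 a c 0) (is_derive_id (0 : C) (1 : C))).
rewrite add0r scale1r; congr is_derive; apply/funext => t /=.
rewrite -[LHS]/(1%:M + t *: mx2 0 a c 0) -mx2_1 mx2Z mx2D.
by rewrite !mulr0 !addr0 !add0r.
Qed.

Lemma additive_group_xp :
  additive_group (dr xp) (fun t => rho (phi (mx2 1 t 0 1))).
Proof.
have [_ dE _ _] := phi_morphism.
have := additive_group_SL2 (mulr0 1) dE.
by congr additive_group; apply/funext => t; rewrite mulr1 mulr0.
Qed.

Lemma additive_group_xm :
  additive_group (dr xm) (fun t => rho (phi (mx2 1 0 t 1))).
Proof.
have [_ _ _ dF] := phi_morphism.
have := additive_group_SL2 (mul0r 1) dF.
by congr additive_group; apply/funext => t; rewrite mulr1 mulr0.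
Qed.

Lemma SL2_diag (z : C) : z != 0 -> SL2 (mx2 z 0 0 z^-1).
Proof. by move=> z0; apply: SL2_mx2; rewrite mulr0 subr0 divff. Qed.

Lemma multiplicative_group_h :
  multiplicative_group (dr h) (fun z => rho (phi (mx2 z 0 0 z^-1))).
Proof.
split.
- by rewrite invr1 mx2_1 repr_SL2_1.
- move=> s t s0 t0; rewrite -repr_SL2M ?mulmx2; try exact: SL2_diag.
  by rewrite !(mul0r, mulr0, addr0, add0r) invfM.
have [_ _ dH _] := phi_morphism.
(* [SL2_differential] concerns curves at parameter 0, so the torus is first parametrized by 1 + t;
   the shift s - 1 brings it back at the end. *)
pose gamma t : 'M[C]_2 := mx2 (1 + t) 0 0 (1 + t)^-1.
have d1 : is_derive (0 : C) (1 : C) (fun t => 1 + t) 1.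
  have := is_deriveD (is_derive_cst (1 : C) (0 : C) (1 : C))
    (is_derive_id (0 : C) (1 : C)).
  by rewrite add0r.
have d2 : is_derive (0 : C) (1 : C) (fun t => (1 + t)^-1) (- 1).
  have dV := @is_derive_inv C (1 + 0).
  rewrite addr0 in dV; have {}dV := dV (oner_neq0 _).
  have := @is_derive1_comp_num C (fun y => y^-1) (fun t => 1 + t) 0 _ _ _ d1.
  by rewrite addr0 => /(_ _ dV); rewrite mul1r expr1n invr1.
have dgam : is_derive (0 : C) 1 gamma (mx2 1 0 0 (-1)).
  have := is_deriveD (is_derive_scalel (mx2 1 0 0 0) d1)
    (is_derive_scalel (mx2 0 0 0 1) d2).
  rewrite !mx2Z mx2D !(mulr0, mulr1, addr0, add0r).
  congr is_derive; apply/funext => t /=.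
  rewrite -[LHS]/((1 + t) *: mx2 1 0 0 0 + (1 + t)^-1 *: mx2 0 0 0 1).
  by rewrite !mx2Z mx2D /gamma !(mulr0, mulr1, addr0, add0r).
have gam1 : gamma 0 = 1%:M by rewrite /gamma addr0 invr1 mx2_1.
have nS : \forall t \near (0 : C), SL2 (gamma t).
  have n0 : \forall s \near (1 : C), s != 0.
    by apply: near_neq0; exact: oner_neq0.
  have c1 : (1 + t) @[t --> (0 : C)] --> (1 : C).
    rewrite -[X in _ --> X]addr0.
    apply: (@differentiable_continuous C C C 0 (fun t => 1 + t)).
    by apply/derivable1_diffP; case: d1.
  have n1 : \forall t \near (0 : C), 1 + t != 0 by apply: c1 n0.
  by apply: filterS n1 => t t0; apply: SL2_diag.
have := mx_derive_SL2 dH gam1 nS dgam.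
have d3 : is_derive (1 : C) (1 : C) (fun s : C => s - 1) 1.
  have := is_deriveB (is_derive_id (1 : C) (1 : C))
    (is_derive_cst (1 : C) (1 : C) (1 : C)).
  by rewrite subr0.
move=> d.
have := @mx_derive_comp C _ _ (fun t => rho (phi (gamma t))) (fun s => s - 1) 1
  (dr h) 1.
rewrite subrr scale1r => /(_ d d3).
by congr mx_derive; apply/funext => z; rewrite /= /gamma subrKC.
Qed.

End OneParameter.

(** * Commutation relations between root subgroups and tori *)

Section Relations.
Variables (R : realType) (n : nat) (G : topGroupType).
Variable L : complexLieGroup R n G.
Variables (e : chart R n G) (atlas_e : atlas L e) (dom_e : chart_dom e 1%g).
Variables (m : nat) (rho : G -> 'M[R[i]]_m) (rho_repr : representation L rho).
Local Notation C := R[i].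
Local Notation dr := (repr_diff e rho).

(** A zero bracket makes the two generators commute. Intertwining once replaces the first generator
    by its group, and a second time replaces the other one. *)
Lemma SL2_unipotent_commute (xp1 h1 xm1 xp2 h2 xm2 : 'rV[C]_n)
    (phi1 phi2 : 'M[C]_2 -> G) s t :
  SL2_triple_morphism L e xp1 h1 xm1 phi1 ->
  SL2_triple_morphism L e xp2 h2 xm2 phi2 ->
  is_lie_bracket e xp1 xm2 0 ->
  rho (phi1 (mx2 1 s 0 1)) *m rho (phi2 (mx2 1 0 t 1)) =
  rho (phi2 (mx2 1 0 t 1)) *m rho (phi1 (mx2 1 s 0 1)).
Proof.
move=> p1 p2 br.
have gx := additive_group_xp atlas_e dom_e rho_repr p1.
have gy := additive_group_xm atlas_e dom_e rho_repr p2.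
have : dr 0 = dr xp1 *m dr xm2 - dr xm2 *m dr xp1.
  exact: (repr_diff_bracket atlas_e dom_e rho_repr br).
rewrite /repr_diff linear0 => /esym/eqP; rewrite subr_eq0 => /eqP c0.
have c1 := additive_group_intertwine s gx gx (esym c0).
exact: (additive_group_intertwine t gy gy (esym c1)).
Qed.

(** The bracket relation reads X h = (h - a) X, so X intertwines z^h with z^(h - a), which is the
    group [k]. Hence z^h X = (z^a X) z^h, and this passes to the additive group generated by X. *)
Lemma torus_conjg (h X : 'rV[C]_n) (a : int) (H u : C -> 'M[C]_m) (z t : C) :
  multiplicative_group (dr h) H -> additive_group (dr X) u ->
  is_lie_bracket e h X (X *~ a) -> z != 0 ->
  H z *m u t = u (z ^ a * t) *m H z.
Proof.
move=> gH gu br z0.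
have [H1 HM dH] := gH.
have : dr (X *~ a) = dr h *m dr X - dr X *m dr h.
  exact: (repr_diff_bracket atlas_e dom_e rho_repr br).
rewrite /repr_diff raddfMz -/(dr X) -/(dr h) => cXH.
pose k (y : C) : 'M[C]_m := y ^ (- a) *: H y.
have gk : multiplicative_group (dr h - (a%:~R)%:M) k.
  split.
  - by rewrite /k exp1rz scale1r.
  - move=> s t0 s0 t00; rewrite /k HM // -scalemxAl -scalemxAr scalerA.
    by rewrite exprzMl ?unitfE.
  have := mx_deriveZ (is_derive_exprz1 C (- a)) dH.
  rewrite exp1rz scale1r H1.
  suff -> : (- a)%:~R *: 1%:M = - (a%:~R)%:M :> 'M[C]_m by [].
  by rewrite mulrNz scaleNr scalemx1.
have XH : dr X *m dr h = (dr h - (a%:~R)%:M) *m dr X.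
  rewrite mulmxBl mul_scalar_mx scaler_int cXH.
  by rewrite opprB addrC subrK.
have c1 := multiplicative_group_intertwine gH gk XH z0.
have zE : z ^ a * z ^ (- a) = 1 by rewrite -expfzDr // subrr expr0z.
have c2 : H z *m dr X = (z ^ a *: dr X) *m H z.
  by rewrite -scalemxAl c1 /k -scalemxAl scalerA zE scale1r.
exact: (additive_group_intertwine t gu (additive_groupZ (z ^ a) gu) c2).
Qed.

End Relations.

(** * The identity in a ring with a trace *)

Section RingProducts.
Variables (S : pzRingType) (I : eqType).

(** Each [Q k] moves left past the [P i] of the later letters, all different from [k] because [s]
    has no repetition. *)
Lemma prodr_mul_commute (s : seq I) (P Q : I -> S) :
  uniq s -> (forall i j, i != j -> Q i * P j = P j * Q i) ->
  (\prod_(i <- s) P i) * (\prod_(i <- s) Q i) = \prod_(i <- s) (P i * Q i).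
Proof.
move=> us cPQ; elim: s us => [|k s IH] /=; first by rewrite !big_nil mulr1.
case/andP=> ks us; rewrite !big_cons -(IH us).
suff cQ : Q k * \prod_(i <- s) P i = \prod_(i <- s) P i * Q k.
  by rewrite mulrA -(mulrA (P k)) -cQ !mulrA.
rewrite big_seq; elim/big_rec: _ => [|i p si IHp]; first by rewrite mul1r mulr1.
rewrite mulrA cPQ; first by rewrite -!mulrA IHp.
by apply: contraNneq ks => ->.
Qed.

Lemma prodr_intertwine (s : seq I) (P Q : I -> S) x :
  (forall i, x * P i = Q i * x) ->
  x * (\prod_(i <- s) P i) = (\prod_(i <- s) Q i) * x.
Proof.
move=> PQ; elim: s => [|k s IH]; first by rewrite !big_nil mulr1 mul1r.
by rewrite !big_cons mulrA PQ -mulrA IH mulrA.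
Qed.

Lemma prodrM_commute (s : seq I) (P Q : I -> S) :
  (forall i j, Q i * P j = P j * Q i) ->
  (\prod_(i <- s) P i) * (\prod_(i <- s) Q i) = \prod_(i <- s) (P i * Q i).
Proof.
move=> cPQ; elim: s => [|k s IH]; first by rewrite !big_nil mulr1.
rewrite !big_cons -IH [RHS]mulrA -(mulrA (P k) (Q k)).
by rewrite (prodr_intertwine _ (cPQ k)) !mulrA.
Qed.

Lemma perm_prodr (s t : seq I) (P : I -> S) :
  (forall i j, P i * P j = P j * P i) -> perm_eq s t ->
  \prod_(i <- s) P i = \prod_(i <- t) P i.
Proof.
move=> cP; elim: s t => [|k s IH] t st.
  by rewrite perm_sym in st; rewrite (perm_nilP st).
have kt : k \in t by rewrite -(perm_mem st) mem_head.
case/splitPr: kt st => t1 t2 st.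
have : perm_eq (k :: s) (k :: t1 ++ t2).
  by apply: perm_trans st _; rewrite -cat1s perm_catCA.
rewrite perm_cons => /IH E; rewrite big_cons E !big_cat big_cons /=.
by rewrite !mulrA (prodr_intertwine t1 (cP k)).
Qed.

End RingProducts.

(** * Families of SL_2 images in a ring, with the torus relations *)

Section SL2Family.
Variables (K : fieldType) (S : pzRingType) (r : nat) (a : 'M[int]_r).
Variable Phi : 'I_r -> 'M[K]_2 -> S.
Hypothesis Phi1 : forall i, Phi i 1%:M = 1.
Hypothesis PhiM : forall i M N, \det M = 1 -> \det N = 1 ->
  Phi i (M *m N) = Phi i M * Phi i N.
Let X i t := Phi i (mx2 1 t 0 1).
Let Y i t := Phi i (mx2 1 0 t 1).
Let H i z := Phi i (mx2 z 0 0 z^-1).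
Hypothesis XY : forall i j s t, i != j -> X i s * Y j t = Y j t * X i s.
Hypothesis HX : forall i j z t, z != 0 ->
  H i z * X j t = X j (z ^ a i j * t) * H i z.
Hypothesis HY : forall i j z t, z != 0 ->
  H i z * Y j t = Y j (z ^ (- a i j) * t) * H i z.

Lemma det_unip (t : K) : \det (mx2 1 t 0 1) = 1.
Proof. by rewrite det_mx2 mulr0 subr0 mulr1. Qed.

Lemma det_lunip (t : K) : \det (mx2 1 0 t 1) = 1.
Proof. by rewrite det_mx2 mul0r subr0 mulr1. Qed.

Lemma det_diag2 (z : K) : z != 0 -> \det (mx2 z 0 0 z^-1) = 1.
Proof. by move=> z0; rewrite det_mx2 mul0r subr0 divff. Qed.

Local Lemma detM1 (M N : 'M[K]_2) :
  \det M = 1 -> \det N = 1 -> \det (M *m N) = 1.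
Proof. by rewrite det_mulmx => -> ->; rewrite mulr1. Qed.

(* diag(w, w^-1) = n(c w) n(-c) with n(z) = x(z) y(-z^-1) x(z), for every c:
   conjugation by a torus element only changes c. *)
Lemma torus_factor i c w : c != 0 -> w != 0 ->
  H i w = X i (c * w) * Y i (- (c * w)^-1) * X i (c * w) *
          (X i (- c) * Y i c^-1 * X i (- c)).
Proof.
move=> c0 w0; rewrite /X /Y /H -!PhiM;
  try by do ?[apply: detM1 | exact: det_unip | exact: det_lunip].
by congr (Phi i _); rewrite !mulmx2; congr mx2; field; rewrite ?c0 ?w0.
Qed.

(** Conjugation by [H i z] turns the factorization of [H j w] with constant 1 into the one with
    constant [z ^ a i j], which is a factorization of the same element. *)
Lemma torus_commute i j z w : z != 0 -> w != 0 -> H i z * H j w = H j w * H i z.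
Proof.
move=> z0 w0; set c := z ^ a i j.
have c0 : c != 0 by rewrite expfz_neq0.
rewrite {1}(torus_factor j (oner_neq0 K) w0) (torus_factor j c0 w0).
rewrite invr1 !mul1r.
rewrite !mulrA HX // -/c -!mulrA; congr (_ * _); rewrite mulrA HY // -mulrA.
have -> : z ^ (- a i j) * - w^-1 = - (c * w)^-1.
  by rewrite invfM mulrN -invr_expz.
congr (_ * _); rewrite mulrA HX // -/c -mulrA; congr (_ * _).
rewrite mulrA HX // -/c -mulrA mulrN1; congr (_ * _).
rewrite mulrA HY // -mulrA mulr1 -invr_expz; congr (_ * _).
by rewrite HX // mulrN1.
Qed.

Definition torus (s : seq 'I_r) (u : 'I_r -> K) :=
  \prod_(j <- s) H j (u j).

(* The value of the simple root alpha_k at prod_j u_j^(h_j). *)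
Definition root_char (s : seq 'I_r) (u : 'I_r -> K) (k : 'I_r) :=
  \prod_(j <- s) u j ^ a j k.

Section Torus.
Variables (u : 'I_r -> K) (u_neq0 : forall j, u j != 0).

Lemma root_char_neq0 s k : root_char s u k != 0.
Proof.
rewrite /root_char; elim/big_rec: _ => [|j x _ x0]; first exact: oner_neq0.
by rewrite mulf_neq0 ?expfz_neq0.
Qed.

Lemma torusX s k t : torus s u * X k t = X k (root_char s u k * t) * torus s u.
Proof.
rewrite /torus /root_char; elim: s => [|j s IH].
  by rewrite !big_nil !mul1r mulr1.
by rewrite !big_cons -mulrA IH mulrA HX // !mulrA.
Qed.

Lemma torusY s k t :
  torus s u * Y k t = Y k ((root_char s u k)^-1 * t) * torus s u.
Proof.
rewrite /torus /root_char; elim: s => [|j s IH].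
  by rewrite !big_nil !mul1r invr1 mulr1 mul1r.
by rewrite !big_cons -mulrA IH mulrA HY // -invr_expz invfM !mulrA.
Qed.

Lemma torus_rcons s k : torus (rcons s k) u = torus s u * H k (u k).
Proof. by rewrite /torus -cats1 big_cat big_seq1. Qed.

Lemma torusM v s : (forall j, v j != 0) ->
  torus s u * torus s v = torus s (fun j => u j * v j).
Proof.
move=> v_neq0; rewrite /torus prodrM_commute;
  last by move=> i j; exact: torus_commute.
apply: eq_bigr => j _; rewrite /H -PhiM ?det_diag2 // mulmx2.
by rewrite !(mulr0, mul0r, addr0, add0r) invfM.
Qed.

Lemma perm_torus s t : perm_eq s t -> torus s u = torus t u.
Proof. by apply: perm_prodr => i j; exact: torus_commute. Qed.

End Torus.

Lemma torusC u v s : (forall j, u j != 0) -> (forall j, v j != 0) ->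
  torus s u * torus s v = torus s v * torus s u.
Proof.
by move=> u0 v0; rewrite !torusM //; apply: eq_bigr => j _; rewrite mulrC.
Qed.

Lemma torus1 s : torus s (fun=> 1) = 1.
Proof. by rewrite /torus big1 // => j _; rewrite /H invr1 mx2_1 Phi1. Qed.

Variables (s : seq 'I_r) (s_uniq : uniq s).

(** The torus parts are collected on the right: the factor at letter i is crossed by those of the
    letters before it, which rescale its argument by the root character of the prefix. The induction
    adds the last letter, crossed by the whole torus collected so far. *)
Lemma prod_upper (b u : 'I_r -> K) : (forall j, u j != 0) ->
  \prod_(i <- s) (X i (b i) * H i (u i)) =
  \prod_(i <- s) X i (root_char (take (index i s) s) u i * b i) * torus s u.
Proof.
move=> u0; elim/last_ind: s s_uniq => [|t k IH].
  by rewrite /torus !big_nil mulr1.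
rewrite rcons_uniq => /andP[kt ut].
rewrite -[in LHS]cats1 big_cat big_seq1 /= {}IH // torus_rcons.
rewrite -[in X in _ = X * _]cats1 big_cat big_seq1 /=.
rewrite mulrA -(mulrA _ (torus t u)) torusX // !mulrA; congr (_ * _ * _ * _).
  rewrite !big_seq; apply: eq_bigr => i it.
  by rewrite -?cats1 index_cat it takel_cat // index_size.
by rewrite -?cats1 index_cat (negPf kt) /= eqxx addn0 take_size_cat.
Qed.

(** Mirror image of [prod_upper]: the torus parts are collected on the left, so the factor at letter
    i is crossed by those of the letters strictly after it. The induction adds a first letter. *)
Lemma prod_lower (b u : 'I_r -> K) : (forall j, u j != 0) ->
  \prod_(i <- s) (H i (u i) * Y i (b i)) =
  torus s u * \prod_(i <- s) Y i (root_char (drop (index i s).+1 s) u i * b i).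
Proof.
move=> u0; elim: s s_uniq => [|k t IH] /=.
  by rewrite /torus !big_nil mulr1.
case/andP=> kt ut; rewrite !big_cons {}IH // eqxx /= drop0.
rewrite /torus big_cons -/(torus t u) -!mulrA; congr (_ * _).
rewrite [RHS]mulrA torusY // mulKf ?root_char_neq0 // -mulrA.
congr (_ * (_ * _)).
rewrite !big_seq; apply: eq_bigr => i it.
by rewrite (negPf (_ : k != i)) //; apply: contraNneq kt => ->.
Qed.

Variable tr : S -> K.
Hypothesis trC : forall x y, tr (x * y) = tr (y * x).

(** Torus elements commute, so conjugating by [torus s v] leaves [torus s u] in place and turns [M]
    into [M'], while the trace does not change. *)
Lemma tr_torus_conjg u v M M' : (forall j, u j != 0) -> (forall j, v j != 0) ->
  torus s v * M = M' * torus s v -> tr (torus s u * M) = tr (torus s u * M').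
Proof.
move=> u0 v0 vM.
have vV0 j : (v j)^-1 != 0 by rewrite invr_eq0.
have vV : torus s v * torus s (fun j => (v j)^-1) = 1.
  by rewrite torusM // -[RHS](torus1 s); apply: eq_bigr => j _; rewrite divff.
have Vv : torus s (fun j => (v j)^-1) * torus s v = 1 by rewrite torusC.
rewrite -[in RHS](mulr1 M') -vV (mulrA M') -vM !mulrA (torusC _ u0 v0).
by rewrite [RHS]trC !mulrA Vv mul1r.
Qed.

Section Conjugate.
Variables (u v b c : 'I_r -> K).
Hypotheses (u_neq0 : forall j, u j != 0) (v_neq0 : forall j, v j != 0).
Hypothesis v_b : forall k, root_char s v k = b k.

(** Conjugation by [torus s v] multiplies the argument of [X i] by [b i] and divides that of [Y i]
    by it, giving Y(-1) X(c b), whose matrix product is the one displayed. *)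
Lemma tr_torus_YX :
  tr (torus s u * \prod_(i <- s) (Y i (- b i) * X i (c i))) =
  tr (torus s u *
    \prod_(i <- s) Phi i (mx2 1 (c i * b i) (-1) (1 - c i * b i))).
Proof.
apply: (tr_torus_conjg u_neq0 v_neq0); apply: prodr_intertwine => i.
have b0 : b i != 0 by rewrite -v_b root_char_neq0.
rewrite mulrA torusY // -mulrA torusX // mulrA v_b mulrN mulVf //.
rewrite /X /Y -PhiM ?det_unip ?det_lunip // mulmx2.
by congr (Phi i (mx2 _ _ _ _) * _); ring.
Qed.

Lemma tr_torus_XY :
  tr (torus s u * \prod_(i <- s) (X i (c i) * Y i (- b i))) =
  tr (torus s u *
    \prod_(i <- s) Phi i (mx2 (1 - c i * b i) (c i * b i) (-1) 1)).
Proof.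
apply: (tr_torus_conjg u_neq0 v_neq0); apply: prodr_intertwine => i.
have b0 : b i != 0 by rewrite -v_b root_char_neq0.
rewrite mulrA torusX // -mulrA torusY // mulrA v_b mulrN mulVf //.
rewrite /X /Y -PhiM ?det_unip ?det_lunip // mulmx2.
by congr (Phi i (mx2 _ _ _ _) * _); ring.
Qed.

End Conjugate.

Lemma tr_ULinv (A B C D v : 'I_r -> K) :
  (forall i, A i != 0) -> (forall i, D i != 0) -> (forall i, v i != 0) ->
  let V i := B i * A i * root_char (take (index i s) s) A i in
  let W i := C i * (D i)^-1 * (root_char (drop (index i s).+1 s) D i)^-1 in
  let u i := A i / D i in
  (forall k, root_char s v k = W k) ->
  let UL := (\prod_(i <- s) Phi i (mx2 (A i) (B i) 0 (A i)^-1)) *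
            \prod_(i <- s) Phi i (mx2 (D i)^-1 0 (- C i) (D i)) in
  tr UL = tr (torus s u * \prod_(i <- s)
     Phi i (mx2 1 (V i * W i) (-1) (1 - V i * W i))) /\
  tr UL = tr (torus s u * \prod_(i <- s)
     Phi i (mx2 (1 - V i * W i / root_char s u i)
                (V i * W i / root_char s u i) (-1) 1)).
Proof.
move=> A0 D0 v0 V W u vW UL.
have DV0 i : (D i)^-1 != 0 by rewrite invr_eq0.
have u0 i : u i != 0 by rewrite mulf_neq0.
have UE : \prod_(i <- s) Phi i (mx2 (A i) (B i) 0 (A i)^-1) =
    (\prod_(i <- s) X i (V i)) * torus s A.
  under eq_bigr => i _.
    rewrite (_ : mx2 _ _ _ _ =
        mx2 1 (B i * A i) 0 1 *m mx2 (A i) 0 0 (A i)^-1); last first.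
      by rewrite mulmx2 !(mulr0, mul0r, addr0, add0r, mul1r) mulfK.
    rewrite PhiM ?det_unip ?det_diag2 //.
    over.
  rewrite (prod_upper (fun i => B i * A i) A0); congr (_ * _).
  by apply: eq_bigr => i _; rewrite /V [in RHS]mulrC.
have LE : \prod_(i <- s) Phi i (mx2 (D i)^-1 0 (- C i) (D i)) =
    torus s (fun i => (D i)^-1) * (\prod_(i <- s) Y i (- W i)).
  under eq_bigr => i _.
    rewrite (_ : mx2 _ _ _ _ = mx2 (D i)^-1 0 0 (D i)^-1^-1 *m
        mx2 1 0 (- (C i * (D i)^-1)) 1); last first.
      rewrite mulmx2 !(mulr0, mul0r, addr0, add0r, mulr1) invrK mulrN.
      by rewrite mulrC mulfVK.
    rewrite PhiM ?det_lunip ?det_diag2 //.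
    over.
  rewrite (prod_lower (fun i => - (C i * (D i)^-1)) DV0); congr (_ * _).
  apply: eq_bigr => i _; rewrite /W mulrN [in RHS]mulrC.
  congr (Y i (- (_ * _))); rewrite /root_char -prodfV.
  by apply: eq_bigr => j _; rewrite exprz_inv invr_expz.
have ULE : UL =
    (\prod_(i <- s) X i (V i)) * torus s u * (\prod_(i <- s) Y i (- W i)).
  by rewrite /UL UE LE !mulrA -[in RHS](torusM A0 s DV0) !mulrA.
split.
  (* The trace carries the product of the X's from the front to the end, after the Y's. *)
  rewrite -(tr_torus_YX _ u0 v0 vW) ULE -!mulrA trC -!mulrA.
  rewrite prodr_mul_commute //.
  by move=> i j ij; rewrite XY.
pose V' i := V i / root_char s u i.
under [in RHS]eq_bigr => i _ do rewrite mulrAC.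
rewrite -(tr_torus_XY _ u0 v0 vW) ULE.
(* The torus is moved to the front instead, which divides each [V i] by the root character. *)
have -> : (\prod_(i <- s) X i (V i)) * torus s u =
    torus s u * \prod_(i <- s) X i (V' i).
  apply/esym; apply: prodr_intertwine => i.
  by rewrite torusX // /V' mulrCA divff ?mulr1 // root_char_neq0.
rewrite -mulrA prodr_mul_commute //.
by move=> i j ij; rewrite XY // eq_sym.
Qed.

End SL2Family.

(** * Cartan matrices and Coxeter elements *)

Section Cartan.
Variables (r : nat) (a : 'M[int]_r).

Lemma cartan_det_neq0 : cartan_matrix a -> \det a != 0.
Proof.
case=> _ _ _ [d [d0 dsym dpos]].
rewrite -(intr_eq0 rat) -det_map_mx -det_tr.
apply/negP => /eqP/eqP/det0P[v v0 va].
have /dpos : exists i, v 0 i != 0.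
  by move/rV0Pn: v0.
(* A kernel vector makes every inner sum over j vanish, contradicting positivity of the form. *)
rewrite big1 ?ltxx // => i _.
have : (v *m (map_mx intr a)^T) 0 i = 0 by rewrite va mxE.
rewrite mxE => vai.
rewrite (eq_bigr (fun j => v 0 i * d i * (v 0 j * (map_mx intr a)^T j i))).
  by rewrite -mulr_sumr vai mulr0.
by move=> j _; rewrite !mxE; ring.
Qed.

(** Extracting roots of order [\det a] of the [b l] and raising them to the entries of the adjugate
    solves the system, since [\adj a *m a] is the scalar matrix [\det a]. *)
Lemma root_char_surj (K : numClosedFieldType) (s : seq 'I_r) (b : 'I_r -> K) :
  \det a != 0 -> perm_eq s (enum 'I_r) -> (forall k, b k != 0) ->
  exists2 v, forall j, v j != 0 & forall k, root_char a s v k = b k.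
Proof.
move=> det0 sE b0.
have rootz (x : K) : x != 0 -> exists2 y, y != 0 & y ^ \det a = x.
  move=> x0; case: (\det a) det0 => n n0.
    have n0' : (0 < n)%N by rewrite lt0n; apply: contraNneq n0 => ->.
    by exists (n.-root x); rewrite ?rootC_eq0 // -exprnP rootCK.
  (* For a negative determinant the inverse of the root is taken. *)
  exists (n.+1.-root x)^-1; rewrite ?invr_eq0 ?rootC_eq0 //.
  by rewrite NegzE -exprnN exprVn invrK rootCK.
have /choice[y /all_and2[y0 yE]] k : exists z, z != 0 /\ z ^ \det a = b k.
  by have [z] := rootz _ (b0 k); exists z.
exists (fun j => \prod_l y l ^ (\adj a) l j) => [j|k].
  by apply/prodf_neq0 => l _; rewrite expfz_neq0.
rewrite /root_char (perm_big _ sE) /= big_enum /=.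
transitivity (\prod_l y l ^ (\sum_j (\adj a) l j * a j k)).
  have prodz (z : K) F : z != 0 ->
      z ^ (\sum_(j < r) F j) = \prod_(j < r) z ^ F j.
    move=> z0; elim/big_rec2: _ => [|j p q _ <-]; first by rewrite expr0z.
    by rewrite expfzDr.
  under [in RHS]eq_bigr => l _ do rewrite prodz //.
  rewrite exchange_big /=; apply: eq_bigr => j _.
  have prodX (n : int) (F : 'I_r -> K) : (\prod_l F l) ^ n = \prod_l F l ^ n.
    by elim/big_rec2: _ => [|l p q _ <-]; rewrite ?exp1rz // expfzMl.
  by rewrite prodX; apply: eq_bigr => l _; rewrite exprz_exp.
rewrite (bigD1 k) //= [X in _ * X]big1 ?mulr1 => [|l lk].
  have : (\adj a *m a) k k = (\det a)%:M k k by rewrite mul_adj_mx.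
  by rewrite mxE [RHS]mxE eqxx mulr1n => ->.
have : (\adj a *m a) l k = (\det a)%:M l k by rewrite mul_adj_mx.
by rewrite mxE [RHS]mxE (negPf lk) mulr0n => ->; rewrite expr0z.
Qed.

Lemma mulmx_reflection (x : 'rV[int]_r) k :
  x *m simple_reflection a k = x - (x 0 k *: delta_mx 0 k) *m a.
Proof.
apply/rowP => l; rewrite !mxE.
under eq_bigr => j _ do rewrite !mxE mulrBr.
rewrite sumrB; congr (_ - _).
  rewrite (bigD1 l) //= big1 ?addr0 ?eqxx ?mulr1 // => j jl.
  by rewrite (negPf jl) mulr0.
rewrite [RHS](bigD1 k) //= [LHS](bigD1 k) //= !big1 ?addr0 => [|j jk|j jk].
- by rewrite !mxE !eqxx mul1r mulr1.
- by rewrite !mxE (negPf jk) andbF mulr0 mul0r.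
- by rewrite (negPf jk) mul0r mulr0.
Qed.

(** Each reflection s_k subtracts a multiple of row k of [a], and [c] records these multiples. As
    letters do not repeat, coordinate k of [c] comes from s_k alone; so if c = 0, no reflection
    moves [x] and each multiple is a coordinate of [x] itself. *)
Lemma mulmx_word (t : seq 'I_r) (x : 'rV[int]_r) : uniq t ->
  exists c : 'rV[int]_r,
    [/\ x *m word_product a t = x - c *m a,
        forall j, j \notin t -> c 0 j = 0 &
        c = 0 -> forall j, j \in t -> x 0 j = 0].
Proof.
rewrite /word_product; elim: t x => [|k t IH] x /=.
  move=> _; exists 0; rewrite big_nil mulmx1 mul0mx subr0.
  by split=> // j; rewrite mxE.
case/andP=> kt /IH{}IH; rewrite big_cons mulmxA mulmx_reflection.
have [c [cE c0 cx]] := IH (x - (x 0 k *: delta_mx 0 k) *m a).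
exists (x 0 k *: delta_mx 0 k + c); split.
- by rewrite cE mulmxDl opprD addrA.
- move=> j; rewrite inE negb_or => /andP[jk jt].
  by rewrite !mxE c0 // eqxx (negPf jk) mulr0 addr0.
move=> xc0.
have xk0 : x 0 k = 0.
  have := congr1 (fun M : 'rV_r => M 0 k) xc0.
  by rewrite !mxE (c0 _ kt) !eqxx mulr1 addr0.
move: xc0 cx; rewrite xk0 scale0r add0r mul0mx subr0 => c00 cx j.
by rewrite inE => /predU1P[->//|jt]; apply: cx.
Qed.

Lemma row_word_notin (t : seq 'I_r) i : i \notin t ->
  delta_mx 0 i *m word_product a t = delta_mx 0 i :> 'rV[int]_r.
Proof.
rewrite /word_product; elim: t => [|k t IH]; first by rewrite big_nil mulmx1.
rewrite inE negb_or => /andP[ik it]; rewrite big_cons mulmxA mulmx_reflection.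
by rewrite mxE eqxx eq_sym (negPf ik) scale0r mul0mx subr0 IH.
Qed.

(** A letter i missing from [s] would make the i-th coordinate form a nonzero row fixed by [w]. By
    [mulmx_word] applied to the Coxeter word [t], and invertibility of [a] over the rationals, a
    fixed row is zero. *)
Lemma coxeter_word_perm w (s : r.-tuple 'I_r) : \det a != 0 ->
  coxeter_element a w -> w = word_product a s -> perm_eq s (enum 'I_r).
Proof.
move=> det0 [t tcount ->] wE.
have tuniq : uniq t.
  by apply: count_mem_uniq => i; rewrite tcount -has_pred1 has_count tcount.
have ins i : i \in tval s.
  apply: contraT => /row_word_notin; rewrite -wE.
  have [c [-> _ cx]] := mulmx_word (delta_mx 0 i) tuniq.
  move/eqP; rewrite -subr_eq0 addrAC subrr add0r oppr_eq0 => /eqP ca0.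
  have c0 : c = 0.
    have : c *m a *m \adj a = 0 by rewrite ca0 mul0mx.
    rewrite -mulmxA mul_mx_adj mul_mx_scalar => /rowP dc.
    apply/rowP => j; move/eqP: (dc j).
    by rewrite !mxE mulf_eq0 (negPf det0) => /eqP.
  have it : i \in t by rewrite -has_pred1 has_count tcount.
  by have := cx c0 i it; rewrite mxE !eqxx.
(* A word of r letters containing all r indices has no repetition. *)
have su : uniq s.
  apply: (@leq_size_uniq _ (enum 'I_r)); rewrite ?enum_uniq //.
  by rewrite size_tuple size_enum_ord.
by apply: uniq_perm; rewrite ?enum_uniq // => i; rewrite ins mem_enum.
Qed.

End Cartan.

(** * Letters before and after a given one, as prefixes and suffixes *)

Section Coordinates.
Variables (r : nat) (w : r.-tuple 'I_r).
Hypothesis w_perm : perm_eq w (enum 'I_r).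

Let w_uniq : uniq w. Proof. by rewrite (perm_uniq w_perm) enum_uniq. Qed.

Let index_tnth (b : 'I_r) : index (tnth w b) w = b.
Proof. by rewrite (tnth_nth (tnth w b)) index_uniq // size_tuple. Qed.

Let mem_w i : i \in w. Proof. by rewrite (perm_mem w_perm) mem_enum. Qed.

Lemma mem_before i j : (j \in before w i) = (index j w < index i w)%N.
Proof.
rewrite inE; apply/existsP/idP => [[b /existsP[c /and3P[/eqP <- /eqP <-]]]|ji].
  by rewrite !index_tnth.
have /tnthP[b ib] := mem_w i; have /tnthP[c jc] := mem_w j.
exists b; apply/existsP; exists c.
by move: ji; rewrite ib jc !index_tnth !eqxx.
Qed.

Lemma mem_after i j : (j \in after w i) = (index i w < index j w)%N.
Proof.
rewrite inE; apply/existsP/idP => [[b /existsP[c /and3P[/eqP <- /eqP <-]]]|ji].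
  by rewrite !index_tnth.
have /tnthP[b ib] := mem_w i; have /tnthP[c jc] := mem_w j.
exists b; apply/existsP; exists c.
by move: ji; rewrite ib jc !index_tnth !eqxx.
Qed.

Lemma mem_drop_index i j :
  (j \in drop (index i w).+1 w) = (index i w < index j w)%N.
Proof.
set k := (index i w).+1.
have : j \in take k w ++ drop k w by rewrite cat_take_drop.
rewrite mem_cat; have : uniq (take k w ++ drop k w) by rewrite cat_take_drop.
rewrite cat_uniq => /and3P[_ /hasPn dis _].
(* The prefix has length [(index i w).+1] and so contains i itself; the suffix consists of the
   letters strictly after i. *)
rewrite [X in X || _]in_take // ltnS.
rewrite /k; case: (boolP (j \in drop _ _)) => [jd _|_]; last first.
  by rewrite orbF => ji; rewrite ltnNge ji.
by have := dis _ jd; rewrite /= in_take // ltnS -ltnNge => ->.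
Qed.

Variables (K : fieldType) (a : 'M[int]_r).

Lemma root_char_before (A : 'I_r -> K) i :
  root_char a (take (index i w) w) A i = \prod_(j in before w i) A j ^ a j i.
Proof.
rewrite /root_char big_uniq ?take_uniq //.
by apply: eq_bigl => j; rewrite mem_before in_take.
Qed.

Lemma root_char_after (D : 'I_r -> K) i :
  (root_char a (drop (index i w).+1 w) D i)^-1 =
  \prod_(j in after w i) D j ^ (- a j i).
Proof.
rewrite /root_char big_uniq ?drop_uniq // -prodfV.
by apply: eq_big => j; rewrite ?mem_after ?mem_drop_index // invr_expz.
Qed.

End Coordinates.

Section Morphism.
Variables (R : realType) (n : nat) (G : topGroupType).
Variable L : complexLieGroup R n G.
Variables (m : nat) (rho : G -> 'M[R[i]]_m) (rho_repr : representation L rho).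

Lemma repr_prod (I : Type) (s : seq I) (g : I -> G) :
  rho (\big[*%g/1%g]_(i <- s) g i) = \prod_(i <- s) (rho (g i) : 'M[R[i]]_m).
Proof.
elim: s => [|k s IH]; first by rewrite !big_nil (repr1 rho_repr).
by rewrite !big_cons (reprM rho_repr) IH.
Qed.

End Morphism.

(** * The character identities *)

Theorem proposition8 (R : realType) (n : nat) (G : topGroupType)
    (L : complexLieGroup R n G)
    (e : chart R n G) (atlas_e : atlas L e) (dom_e : chart_dom e 1%g)
    (G_connected : connected [set: G])
    (G_simply_connected : simply_connected R G)
    (G_simple : simple_lie_algebra e)
    (r : nat) (a : 'M[int]_r) (a_cartan : cartan_matrix a)
    (xp xm h : 'I_r -> 'rV[R[i]]_n)
    (xp_xm_h_chevalley : chevalley_generators e a xp xm h)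
    (phi : 'I_r -> 'M[R[i]]_2 -> G)
    (phi_morphism : forall i : 'I_r,
       SL2_triple_morphism L e (xp i) (h i) (xm i) (phi i))
    (w : 'M[int]_r) (w_coxeter : coxeter_element a w)
    (s : r.-tuple 'I_r) (s_reduced : reduced_decomposition a w s)
    (A B C D : 'I_r -> R[i])
    (A_neq0 : forall i : 'I_r, A i != 0) (B_neq0 : forall i : 'I_r, B i != 0)
    (C_neq0 : forall i : 'I_r, C i != 0) (D_neq0 : forall i : 'I_r, D i != 0)
    (m : nat) (rho : G -> 'M[R[i]]_m) (rho_repr : representation L rho) :
  character rho (ULinv phi s A B C D) =
    character rho (chi_torus phi A D
      * \big[*%g/1%g]_(i <- s) phi i (gmx a s A B C D i))%g
  /\
  character rho (ULinv phi s A B C D) =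
    character rho (chi_torus phi A D
      * \big[*%g/1%g]_(i <- s) phi i (gbarmx a s A B C D i))%g.
Proof.
have det0 := cartan_det_neq0 a_cartan.
have s_perm := coxeter_word_perm det0 w_coxeter s_reduced.1.
have s_uniq : uniq s by rewrite (perm_uniq s_perm) enum_uniq.
pose Phi i M : 'M[R[i]]_m := rho (phi i M).
have Phi1 i : Phi i 1%:M = 1 by exact: (repr_SL2_1 rho_repr (phi_morphism i)).
have PhiM i M N : \det M = 1 -> \det N = 1 ->
    Phi i (M *m N) = Phi i M * Phi i N.
  exact: (repr_SL2M rho_repr (phi_morphism i)).
have XY i j (x y : R[i]) : i != j ->
    Phi i (mx2 1 x 0 1) * Phi j (mx2 1 0 y 1) =
    Phi j (mx2 1 0 y 1) * Phi i (mx2 1 x 0 1).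
  move=> ij; have := chevalley_pm xp_xm_h_chevalley i j; rewrite (negPf ij).
  exact: (SL2_unipotent_commute atlas_e dom_e rho_repr _ _
    (phi_morphism i) (phi_morphism j)).
have HX i j (z t : R[i]) : z != 0 ->
    Phi i (mx2 z 0 0 z^-1) * Phi j (mx2 1 t 0 1) =
    Phi j (mx2 1 (z ^ a i j * t) 0 1) * Phi i (mx2 z 0 0 z^-1).
  move=> z0; exact: (torus_conjg atlas_e dom_e rho_repr t
    (multiplicative_group_h atlas_e dom_e rho_repr (phi_morphism i))
    (additive_group_xp atlas_e dom_e rho_repr (phi_morphism j))
    (chevalley_hp xp_xm_h_chevalley i j) z0).
have HY i j (z t : R[i]) : z != 0 ->
    Phi i (mx2 z 0 0 z^-1) * Phi j (mx2 1 0 t 1) =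
    Phi j (mx2 1 0 (z ^ (- a i j) * t) 1) * Phi i (mx2 z 0 0 z^-1).
  move=> z0; have br := chevalley_hm xp_xm_h_chevalley i j.
  rewrite -mulrNz in br.
  exact: (torus_conjg atlas_e dom_e rho_repr t
    (multiplicative_group_h atlas_e dom_e rho_repr (phi_morphism i))
    (additive_group_xm atlas_e dom_e rho_repr (phi_morphism j)) br z0).
have VE i : Vcoord a s A B i = B i * A i * root_char a (take (index i s) s) A i.
  by rewrite root_char_before.
have WE i : Wcoord a s C D i =
    C i * (D i)^-1 * (root_char a (drop (index i s).+1 s) D i)^-1.
  by rewrite root_char_after.
have W0 i : Wcoord a s C D i != 0.
  by rewrite WE !mulf_neq0 ?invr_eq0 // root_char_neq0.
(* The torus element whose simple roots take the values W_i, used for the final conjugation. *)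
have [v v0 vW] := root_char_surj det0 s_perm W0.
(* Inverses of the lower triangular factors are computed inside SL_2, where [phi i] is
   multiplicative. *)
have phiV i : (phi i (mx2 (D i) 0 (C i) (D i)^-1%R))^-1%g =
    phi i (mx2 (D i)^-1 0 (- C i) (D i)).
  have [[phi1 phiM _ _] _ _ _] := phi_morphism i.
  rewrite -[LHS]mulg1 -phi1 -mx2_1.
  have -> : mx2 1 0 0 1 =
      mx2 (D i) 0 (C i) (D i)^-1 *m mx2 (D i)^-1 0 (- C i) (D i).
    rewrite mulmx2 !(mulr0, mul0r, addr0, add0r) divff // mulVf //.
    by rewrite mulrN [_^-1 * _]mulrC subrr.
  by rewrite phiM ?mulKg //; apply: SL2_mx2; rewrite mul0r subr0 ?divff ?mulVf.
have UL_E : rho (ULinv phi s A B C D) =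
    \prod_(i <- s) Phi i (mx2 (A i) (B i) 0 (A i)^-1) *
    \prod_(i <- s) Phi i (mx2 (D i)^-1 0 (- C i) (D i)).
  rewrite /ULinv (reprM rho_repr) !(repr_prod rho_repr); congr (_ * _).
  by apply: eq_bigr => i _; rewrite phiV.
(* [chi_torus] multiplies in the order of the indices and [torus Phi s] in that of the word; torus
   elements commute. *)
have TE : rho (chi_torus phi A D) = torus Phi s (fun i => A i / D i).
  rewrite /chi_torus (repr_prod rho_repr) (perm_torus PhiM HX HY _ s_perm) //.
    by rewrite /torus enumT.
  by move=> i; rewrite mulf_neq0 ?invr_eq0.
have uE i : (root_char a s (fun j => A j / D j) i)^-1 =
    \prod_(j < r) (A j / D j) ^ (- a j i).
  rewrite /root_char (perm_big _ s_perm) /= big_enum -prodfV.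
  by apply: eq_bigr => j _; rewrite invr_expz.
have vC k : root_char a s v k =
    C k * (D k)^-1 * (root_char a (drop (index k s).+1 s) D k)^-1.
  by rewrite vW WE.
have [bar g] := tr_ULinv Phi1 PhiM XY HX HY s_uniq (@mxtrace_mulC _ m m) B
  A_neq0 D_neq0 v0 vC.
rewrite /character UL_E !(reprM rho_repr) TE !(repr_prod rho_repr); split.
  rewrite g; congr (\tr (_ *m _)); apply: eq_bigr => i _; congr (rho (phi i _)).
  by rewrite /gmx /chim /chip VE WE uE.
rewrite bar; congr (\tr (_ *m _)); apply: eq_bigr => i _; congr (rho (phi i _)).
by rewrite /gbarmx /chip VE WE.
Qed.
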